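(* For each integer $n\ge 1$ and each $\varepsilon>0$ there is a constant $c=c(n,\varepsilon)$ such that every finite simplicial complex $M$ whose geometric realization is a closed $n$-dimensional manifold with $H_1(M;\mathbb{Z}/2)\neq 0$ satisfies \[ \operatorname{sys}_1(M)\cdot \operatorname{sys}_{n-1}(M)\le c\,\operatorname{Vol}(M)^{1+\varepsilon}. \]
   Context: $\operatorname{Vol}(M)$ denotes the number of $n$-simplices of $M$. For $0\le k\le n$, the $k$-dimensional mod $2$ systole $\operatorname{sys}_k(M)$ is the minimal number of $k$-simplices in a simplicial $k$-cycle with $\mathbb{Z}/2$ coefficients representing a nonzero class in $H_k(M;\mathbb{Z}/2)$. *)

(* Defs.v *)
From HB Require Import structures.
From mathcomp Require Import all_boot all_order all_algebra.
From mathcomp Require Import all_classical all_reals all_analysis.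
Set Implicit Arguments. Unset Strict Implicit. Unset Printing Implicit Defensive.
Import Order.TTheory GRing.Theory Num.Theory.
Import numFieldNormedType.Exports.
Local Open Scope classical_set_scope.
Local Open Scope ring_scope.

Definition simplicial_complex (N : nat) (K : {set {set 'I_N}}) : Prop :=
  finset.set0 \notin K /\
  forall s t : {set 'I_N}, s \in K -> t \subset s -> t != finset.set0 -> t \in K.

Definition simplices (N : nat) (K : {set {set 'I_N}}) (k : nat) : {set {set 'I_N}} :=
  [set s in K | #|s| == k.+1]%N.

(** A mod 2 simplicial k-chain is a set of k-simplices. *)
Definition chain (N : nat) (K : {set {set 'I_N}}) (k : nat) (c : {set {set 'I_N}}) : bool :=
  c \subset simplices K k.

(** Mod 2 boundary of a k-chain: the (k-1)-faces contained in an odd number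
    of simplices of c (zero when k = 0). *)
Definition boundary (N : nat) (K : {set {set 'I_N}}) (k : nat) (c : {set {set 'I_N}})
  : {set {set 'I_N}} :=
  [set t in K | (#|t| == k)%N && odd #|[set s in c | t \subset s]|].

Definition cycle_mod2 (N : nat) (K : {set {set 'I_N}}) (k : nat) (c : {set {set 'I_N}}) : Prop :=
  chain K k c /\ boundary K k c = finset.set0.

Definition is_boundary_mod2 (N : nat) (K : {set {set 'I_N}}) (k : nat) (c : {set {set 'I_N}}) : Prop :=
  exists d, chain K k.+1 d /\ boundary K k.+1 d = c.

Definition nontrivial_cycle (N : nat) (K : {set {set 'I_N}}) (k : nat) (c : {set {set 'I_N}}) : Prop :=
  cycle_mod2 K k c /\ ~ is_boundary_mod2 K k c.

Definition homology_nonzero (N : nat) (K : {set {set 'I_N}}) (k : nat) : Prop :=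
  exists c, nontrivial_cycle K k c.

(** sys_k(K): minimal number of k-simplices of a nontrivial mod 2 k-cycle.
    (Default value #|{set 'I_N}|.+1, exceeding every chain size, is only
    attained when H_k = 0.) *)
Definition sys (N : nat) (K : {set {set 'I_N}}) (k : nat) : nat :=
  \big[minn/#|{set 'I_N}|.+1]_(c : {set {set 'I_N}} | `[< nontrivial_cycle K k c >]) #|c|.

Definition Vol (N : nat) (K : {set {set 'I_N}}) (n : nat) : nat := #|simplices K n|.

Definition realization (R : realType) (N : nat) (K : {set {set 'I_N}}) : set 'rV[R]_N :=
  [set x : 'rV[R]_N | (forall i, 0 <= x ord0 i) /\ \sum_i x ord0 i = 1 /\
           [set i : 'I_N | x ord0 i != 0]%SET \in K].

(** X is a closed (compact, boundaryless) topological n-manifold: compact,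
    and each point has a relatively open neighbourhood in X homeomorphic
    to R^n. (Hausdorff and second countable are automatic inside R^N.) *)
Definition closed_manifold (R : realType) (N : nat) (X : set 'rV[R]_N) (n : nat) : Prop :=
  compact X /\
  forall x, X x -> exists (O : set 'rV[R]_N) (f : 'rV[R]_N -> 'rV[R]_n) (g : 'rV[R]_n -> 'rV[R]_N),
    open O /\ O x /\
    {within O `&` X, continuous f} /\ continuous g /\
    (forall y, (O `&` X) (g y) /\ f (g y) = y) /\
    (forall z, (O `&` X) z -> g (f z) = z).

(* Main.v *)
Require Import Defs.
From HB Require Import structures.
From mathcomp Require Import all_boot all_order all_algebra.
From mathcomp Require Import all_classical all_reals all_analysis.
From mathcomp Require Import ring lra zify.
Set Implicit Arguments. Unset Strict Implicit. Unset Printing Implicit Defensive.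
Import Order.TTheory GRing.Theory Num.Theory.
Import numFieldNormedType.Exports.
Local Open Scope ring_scope.

(** The triangulation of a closed n-manifold is a pseudomanifold: every simplex lies in an
    n-simplex, every (n-1)-simplex in exactly two, and the n-simplices at a vertex are connected
    across facets.  This follows from an invariance of domain for families A of (n+1)-sets
    containing a fixed simplex tau with even incidences: a continuous injection of the union of A
    into R^n is open at the barycenter of tau.  As in Tao's proof of invariance of domain, a
    missed value would allow deforming a map which Sperner's lemma shows to be essential.

    A nonzero class in H_1 is detected by a mod 2 cocycle a.  Choosing a vertex in each simplex
    turns a into a simplicial (n-1)-cycle supported on the facets of the n-simplices on which a
    does not vanish; it is not a boundary because a is not a coboundary.  Closed edge walks shorter
    than sys_1 have zero period, so a is a coboundary on balls of radius about sys_1 / 2.  Cutting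
    the complex into balls of slow volume growth makes a a coboundary off a proportion alpha of the
    n-simplices, where (1 + alpha)^R >= Vol with R close to sys_1 / 2, and alpha of order
    Vol^eps / sys_1 is admissible. *)

(** * Ordered chains and the combinatorial Sperner lemma *)

(** Links in a triangulated manifold need not be spheres, so its local combinatorics cannot be read
    off a chart; charts enter only through openness of injective maps. The families A are general
    because openness is applied to subfamilies of a star: a nonempty one with even incidences fills
    a neighbourhood of the barycenter of tau, hence accounts for the whole star. Two cofacets of a
    facet form such a family, which bounds their number from above; so do the simplices at a vertex
    on which a function invariant across facets takes one value, which gives connectedness. The
    opposite bounds (every simplex lies in an n-simplex, every facet has a second cofacet) hold
    because a star contained in one simplex would put an open piece of R^n into a half space,
    touching its boundary.

    The Poincare dual of a simplicial cocycle is naturally made of dual cells. *)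

Section OrderedChains.
Local Open Scope nat_scope.
Implicit Types T : Type.

Fixpoint bd T (t : seq T) : seq (seq T) :=
  if t is x :: t' then t' :: map (cons x) (bd t') else [::].

(* Equality of formal sums over F_2, each written as a list of its terms. *)
Definition ceq T (c d : seq T) : Prop := forall a : pred T, odd (count a c) = odd (count a d).

Definition lin T U (F : T -> seq U) (c : seq T) : seq U := flatten (map F c).

(** Over F_2 a predicate is a linear functional, with value [odd (count a c)]. This is its pullback
    along a linear map: chain identities are tested against functionals and lists are never
    normalized. *)
Lemma odd_count_lin T U (F : T -> seq U) (a : pred U) c :
  odd (count a (lin F c)) = odd (count (fun t => odd (count a (F t))) c).
Proof.
elim: c => //= t c IH.
by rewrite /lin /= count_cat !oddD -/(lin F c) IH oddb.
Qed.

Lemma ceq_lin T U (F : T -> seq U) c d : ceq c d -> ceq (lin F c) (lin F d).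
Proof. by move=> cd a; rewrite !odd_count_lin. Qed.

Lemma eq_ceq_lin (T : eqType) U (F G : T -> seq U) (c : seq T) :
  (forall t, t \in c -> ceq (F t) (G t)) -> ceq (lin F c) (lin G c).
Proof.
move=> FG a; rewrite !odd_count_lin; congr odd.
by apply: eq_in_count => t /FG; apply.
Qed.

Lemma lin_lin T U W (F : T -> seq U) (G : U -> seq W) c :
  ceq (lin G (lin F c)) (lin (fun t => lin G (F t)) c).
Proof.
move=> a; rewrite !odd_count_lin; congr odd.
by apply: eq_count => t; rewrite odd_count_lin.
Qed.

Lemma bd_map T U (h : T -> U) t : bd (map h t) = map (map h) (bd t).
Proof. by elim: t => //= x t ->; rewrite -!map_comp. Qed.

Lemma size_bd (T : eqType) (t r : seq T) : r \in bd t -> size r = (size t).-1.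
Proof.
elim: t r => //= x t IH r; rewrite inE => /orP[/eqP-> //|/mapP[r' r'bd ->]] /=.
by rewrite (IH _ r'bd); case: (t) r'bd.
Qed.

Lemma perm_bd (T : eqType) (t r : seq T) : r \in bd t -> exists x, perm_eq t (x :: r).
Proof.
elim: t r => //= x t IH r; rewrite inE => /orP[/eqP-> |/mapP[r' /IH[y tr'] ->]].
  by exists x.
exists y; rewrite -(perm_cons x) in tr'; apply: (perm_trans tr').
by rewrite -cat1s -(cat1s y) -(cat1s y) -(cat1s x r') perm_catCA.
Qed.

Lemma mem_bd (T : eqType) (t r : seq T) : r \in bd t -> {subset r <= t}.
Proof. by move=> /perm_bd[x] /perm_mem tr y yr; rewrite tr inE yr orbT. Qed.

Lemma odd_count_addb T (p q : pred T) c :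
  odd (count (fun r => p r (+) q r) c) = odd (count p c) (+) odd (count q c).
Proof.
elim: c => //= r c IH; rewrite !oddD !oddb IH.
exact: addbACA.
Qed.

Lemma bd_bd T (t : seq T) : ceq (lin (@bd T) (bd t)) [::].
Proof.
elim: t => //= x t IH a; rewrite odd_count_lin /= oddD oddb count_map.
have -> : odd (count (preim (cons x) (fun t => odd (count a (bd t)))) (bd t)) =
   odd (count (fun r => a r (+) odd (count (a \o cons x) (bd r))) (bd t)).
  congr odd; apply: eq_count => r /=.
  by rewrite oddD oddb count_map.
rewrite odd_count_addb addbA addbb -odd_count_lin.
exact: (IH (a \o cons x)).
Qed.

Lemma bd_uniq (T : eqType) (t : seq T) : uniq t -> bd t = [seq rem x t | x <- t].
Proof.
elim: t => //= x t IH /andP[xt ut]; rewrite eqxx IH // -map_comp; congr cons.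
by apply/eq_in_map => y yt /=; case: eqP => // xy; rewrite xy yt in xt.
Qed.

Definition full T (L : T -> nat) m (s : seq T) := perm_eq (map L s) (iota 0 m).

(** Deleting an entry [y] from a permutation of [x :: w] leaves a permutation of [w] exactly when
    [y = x]; multiplicities matter because labels repeat. *)
Lemma count_bd_perm (T : eqType) (x : T) (l w : seq T) :
  perm_eq l (x :: w) -> count (fun r => perm_eq r w) (bd l) = count_mem x l.
Proof.
elim: l w x => [|y l IH] w x lxw /=; first by move/perm_size: lxw.
rewrite count_map.
have [yw|yNw] := boolP (y \in w); last first.
  have := perm_mem lxw y; rewrite !inE eqxx (negbTE yNw) orbF /= => /esym/eqP yx.
  subst y; rewrite perm_cons in lxw; rewrite lxw eqxx; congr addn.
  rewrite (count_memPn _); last by rewrite (perm_mem lxw).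
  apply/eqP; rewrite -leqn0 leqNgt -has_count; apply/hasPn => r _ /=.
  by apply: contra yNw => /perm_mem <-; rewrite inE eqxx.
have ww := perm_to_rem yw; set w' := rem y w in ww.
have E1 : perm_eq l (x :: w').
  rewrite -(perm_cons y); apply: (perm_trans lxw).
  rewrite -(cat1s y) -(cat1s x w') perm_sym perm_catCA /= perm_cons perm_sym.
  exact: ww.
rewrite -(IH w' x) //; congr addn.
  rewrite (perm_sym l) (permPl ww) perm_sym (permPl E1).
  congr nat_of_bool; apply/idP/eqP => [/allP/(_ x)|->//].
  case: (eqVneq y x) => // yx /(_ _).
  move=> H; have := H; rewrite mem_cat inE eqxx /= (negbTE yx) eqxx add0n add1n.
  by move=> /(_ isT)/eqP; lia.
by apply: eq_count => r /=; rewrite (permPr ww) perm_cons.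
Qed.

(** The parity step of Sperner's lemma: a fully labelled cell has one face labelled by 0, ..., m-1,
    and any other cell has none or two. *)
Lemma odd_full_bd T (L : T -> nat) m (s : seq T) : size s = m.+1 ->
  all (fun x => L x < m.+1) s -> odd (count (full L m) (bd s)) = full L m.+1 s.
Proof.
move=> ss sm; rewrite /full.
have -> : count (fun s => perm_eq (map L s) (iota 0 m)) (bd s) =
   count (fun l => perm_eq l (iota 0 m)) (bd (map L s)) by rewrite bd_map count_map.
have : all (fun x => x < m.+1) (map L s) by rewrite all_map.
have : size (map L s) = m.+1 by rewrite size_map.
move: (map L s) => l sl lm.
have iE : perm_eq (iota 0 m.+1) (m :: iota 0 m).
  by rewrite -addn1 iotaD /= add0n cats1 perm_rcons.
have [/hasP[r rl rm]|/hasPn nh] := boolP (has (fun l => perm_eq l (iota 0 m)) (bd l)).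
  have [x lxr] := perm_bd rl.
  have lx : perm_eq l (x :: iota 0 m) by rewrite (permPl lxr) perm_cons.
  rewrite (count_bd_perm lx) (permP lx) /= eqxx (permPl lx) (permPr iE).
  have xm : x < m.+1.
    by move/allP: lm; apply; rewrite (perm_mem lx) inE eqxx.
  have [xlt|xge] := ltnP x m.
    rewrite (count_uniq_mem _ (iota_uniq 0 m)) mem_iota xlt /=.
    apply/esym/negbTE/negP => /perm_uniq; rewrite /= !iota_uniq !mem_iota /= xlt add0n ltnn //=.
  have -> : x = m by lia.
  by rewrite perm_refl (count_memPn _) // mem_iota; lia.
have -> : count (fun l => perm_eq l (iota 0 m)) (bd l) = 0.
  by apply/eqP; rewrite -leqn0 leqNgt -has_count; apply/hasPn.
apply/esym/negbTE/negP => H.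
have lx : perm_eq l (m :: iota 0 m) by rewrite (permPl H).
have := count_bd_perm lx.
rewrite (eqP (_ : count _ _ == 0)); last first.
  by rewrite -leqn0 leqNgt -has_count; apply/hasPn.
by rewrite (permP lx) /= eqxx.
Qed.

Lemma odd_full_bdc (T : eqType) (L : T -> nat) m (c : seq (seq T)) :
  (forall s, s \in c -> size s = m.+1 /\ all (fun x => L x < m.+1) s) ->
  odd (count (full L m) (lin (@bd T) c)) = odd (count (full L m.+1) c).
Proof.
move=> H; rewrite odd_count_lin; congr odd; apply: eq_in_count => s /H[ss sL].
exact: odd_full_bd.
Qed.

End OrderedChains.

(** * Barycentric subdivision *)

Section BarycentricSubdivision.
Variables (R : realType) (V : normedModType R).
Implicit Types (t s : seq V) (P : V -> Prop).

Definition bary t : V := (size t)%:R^-1 *: \sum_(x <- t) x.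

(** Convexity, weakened to what subdivision uses. *)
Definition bary_closed P := forall t, t != [::] -> (forall x, x \in t -> P x) -> P (bary t).

(** Cone from the barycenter over the subdivided boundary. The length [m] drives the recursion
    because faces are not subterms; the empty tuple counts as a cell, so the complex is
    augmented. *)
Fixpoint sd m t : seq (seq V) :=
  if m is m'.+1 then map (cons (bary t)) (lin (sd m') (bd t)) else [:: [::]].

(** The boundary of a cone is its base plus the cone over the boundary of the base. The base is the
    subdivided [bd t], a cycle by induction and [bd_bd]. *)
Lemma bd_sd m t : size t = m -> ceq (lin (@bd V) (sd m t)) (lin (sd m.-1) (bd t)).
Proof.
elim: m t => [[]//|m IH] t st a.
rewrite /= odd_count_lin count_map /=.
have -> : odd (count (preim (cons (bary t)) (fun r => odd (count a (bd r)))) (lin (sd m) (bd t))) =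
   odd (count (fun r => a r (+) odd (count (a \o cons (bary t)) (bd r))) (lin (sd m) (bd t))).
  congr odd; apply: eq_count => r /=.
  by rewrite oddD oddb count_map.
rewrite odd_count_addb -odd_count_lin.
suff bd0 : ceq (lin (@bd V) (lin (sd m) (bd t))) [::] by rewrite bd0 addbF.
move=> b; rewrite lin_lin (eq_ceq_lin (F := fun r => lin (@bd V) (sd m r))
  (G := fun r => lin (sd m.-1) (bd r))); last first.
  by move=> r rt; apply: IH; rewrite (size_bd rt) st.
by rewrite -(lin_lin (@bd V) (sd m.-1)) (ceq_lin _ (bd_bd t)).
Qed.

Lemma size_sd m t s : s \in sd m t -> size s = m.
Proof.
elim: m t s => [|m IH] t s /=; first by rewrite inE => /eqP->.
by move=> /mapP[r /flatten_mapP[r' _ /IH rm] ->] /=; rewrite rm.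
Qed.

Lemma sd_closed P m t : bary_closed P -> size t = m -> (forall x, x \in t -> P x) ->
  forall s, s \in sd m t -> forall x, x \in s -> P x.
Proof.
move=> Pc; elim: m t => [|m IH] t st Pt s /=; first by rewrite inE => /eqP->.
move=> /mapP[r /flatten_mapP[r' r't rr'] ->] x; rewrite inE => /orP[/eqP->|xr].
  by apply: Pc => //; case: (t) st.
apply: (IH r' _ _ r rr' x xr); first by rewrite (size_bd r't) st.
by move=> y /(mem_bd r't); apply: Pt.
Qed.

Lemma sub_bary y t : t != [::] -> y - bary t = (size t)%:R^-1 *: \sum_(x <- t) (y - x).
Proof.
move=> t0; rewrite sumrB scalerBr; congr (_ - _).
rewrite big_const_seq count_predT iter_addr addr0 -[y *+ _]scaler_nat scalerA.
by rewrite mulVf ?scale1r // pnatr_eq0; case: (t) t0.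
Qed.

Lemma ball_bary_closed (y : V) (d : R) : bary_closed (fun x => `|y - x| <= d).
Proof.
move=> t t0 td; have s0 : (0 : R) < (size t)%:R by rewrite ltr0n; case: (t) t0.
rewrite sub_bary; last by case: (t) s0 => //=; rewrite ltxx.
rewrite normrZ gtr0_norm ?invr_gt0 // ler_pdivrMl //.
apply: (le_trans (ler_norm_sum _ _ _)).
rewrite mulr_natl -[leRHS]addr0 -iter_addr -count_predT -big_const_seq.
by rewrite big_seq [leRHS]big_seq; apply: ler_sum.
Qed.

Definition mesh_le (d : R) t := forall x y, x \in t -> y \in t -> `|x - y| <= d.

(** In [sub_bary] the term [y - y] vanishes, so only [size t - 1] differences contribute. *)
Lemma dist_bary d t y : mesh_le d t -> y \in t ->
  `|y - bary t| <= d * (1 - (size t)%:R^-1).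
Proof.
move=> td yt; have s0 : (0 : R) < (size t)%:R by rewrite ltr0n; case: (t) yt.
have d0 : 0 <= d by apply: le_trans (td _ _ yt yt).
rewrite sub_bary; last by case: (t) s0 => //=; rewrite ltxx.
rewrite normrZ gtr0_norm ?invr_gt0 // ler_pdivrMl //.
apply: (le_trans (ler_norm_sum _ _ _)).
have -> : (size t)%:R * (d * (1 - (size t)%:R^-1)) = d * (size t).-1%:R :> R.
  rewrite -subn1 natrB; last by case: (t) yt.
  by field; rewrite gt_eqF.
rewrite (perm_big _ (perm_to_rem yt)) /= big_cons subrr normr0 add0r.
rewrite mulr_natr -(size_rem yt) -[leRHS]addr0 -iter_addr -count_predT -big_const_seq.
rewrite big_seq [leRHS]big_seq; apply: ler_sum => z /mem_rem zt; exact: td.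
Qed.

(** Distances to the barycenter are bounded on the vertices of [t], hence on all cells, as balls are
    closed under barycenters; the other distances shrink by induction with a smaller factor. *)
Lemma mesh_sd m d t : size t = m -> mesh_le d t ->
  forall s, s \in sd m t -> mesh_le (d * (1 - m%:R^-1)) s.
Proof.
elim: m t => [|m IH] t st td s /=.
  by rewrite inE => /eqP-> x y; rewrite in_nil.
have d0 : 0 <= d.
  by case: t st td => // a t _ /(_ a a); rewrite inE eqxx subrr normr0; apply.
move=> /mapP[r /flatten_mapP[r' r't rr'] ->].
have sr' : size r' = m by rewrite (size_bd r't) st.
have le1 y : y \in r -> `|bary t - y| <= d * (1 - m.+1%:R^-1).
  apply: (sd_closed (@ball_bary_closed (bary t) _) sr' _ rr') => x /(mem_bd r't) xt.
  by rewrite -st distrC; apply: dist_bary.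
move=> x y; rewrite !inE => /orP[/eqP->|xr] /orP[/eqP->|yr].
- rewrite subrr normr0 mulr_ge0 // subr_ge0 invf_le1 ?ltr0n //.
  by rewrite ler1n.
- exact: le1.
- by rewrite distrC; apply: le1.
have r'd : mesh_le d r' by move=> u v /(mem_bd r't) ut /(mem_bd r't) vt; apply: td.
apply: (le_trans (IH r' sr' r'd r rr' x y xr yr)).
rewrite ler_wpM2l // lerB // lef_pV2 ?posrE ?ltr0n ?ler_nat //.
by case: (m) (size_sd rr') => // /size0nil r0; rewrite r0 in xr.
Qed.

Definition sdc m (c : seq (seq V)) := lin (sd m) c.

Lemma size_sdc k m c s : (forall t, t \in c -> size t = m) ->
  s \in iter k (sdc m) c -> size s = m.
Proof.
case: k => [|k] cm /=; first exact: cm.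
by move=> /flatten_mapP[t _ /size_sd].
Qed.

Lemma bd_sdc k m c : (forall t, t \in c -> size t = m) ->
  ceq (lin (@bd V) (iter k (sdc m) c)) (iter k (sdc m.-1) (lin (@bd V) c)).
Proof.
move=> cm; elim: k => [|k IH] //= a.
rewrite /sdc lin_lin (eq_ceq_lin (F := fun r => lin (@bd V) (sd m r))
  (G := fun r => lin (sd m.-1) (bd r))); last first.
  by move=> t /(size_sdc cm); apply: bd_sd.
by rewrite -(lin_lin (@bd V) (sd m.-1)) (ceq_lin _ IH).
Qed.

Lemma iter_sdc_closed P k m c : bary_closed P -> (forall t, t \in c -> size t = m) ->
  (forall t, t \in c -> forall x, x \in t -> P x) ->
  forall s, s \in iter k (sdc m) c -> forall x, x \in s -> P x.
Proof.
move=> Pc cm Pt; elim: k => [|k IH] //= s /flatten_mapP[t tc st].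
by apply: (sd_closed Pc (size_sdc cm tc) _ st); apply: IH.
Qed.

Lemma mesh_sdc k m d c : (forall t, t \in c -> size t = m) ->
  (forall t, t \in c -> mesh_le d t) ->
  forall s, s \in iter k (sdc m) c -> mesh_le (d * (1 - m%:R^-1) ^+ k) s.
Proof.
move=> cm cd; elim: k => [|k IH] s /=; first by rewrite expr0 mulr1; apply: cd.
move=> /flatten_mapP[t tc st]; rewrite exprSr mulrA.
by apply: (mesh_sd _ _ st); [apply: size_sdc tc | apply: IH].
Qed.

Lemma iter_sdc_lin k m c : ceq (iter k (sdc m) c) (lin (fun t => iter k (sdc m) [:: t]) c).
Proof.
elim: k => [|k IH] /= a.
  by rewrite odd_count_lin; congr odd; apply: eq_count => t /=; rewrite addn0 oddb.
by rewrite {1}/sdc (ceq_lin _ IH) lin_lin.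
Qed.

End BarycentricSubdivision.

(** * A relative Sperner lemma *)

Section SimplexPoints.
Variables (R : realType) (N : nat).
Implicit Types (x y : 'rV[R]_N) (s t : {set 'I_N}).

Definition in_simplex s x : Prop :=
  (forall i, 0 <= x ord0 i) /\ \sum_i x ord0 i = 1 /\ (forall i, i \notin s -> x ord0 i = 0).

Definition vertex (i : 'I_N) : 'rV[R]_N := delta_mx ord0 i.

Definition center t : 'rV[R]_N := \row_i (if i \in t then (#|t|%:R)^-1 else 0).

Lemma baryE (t : seq 'rV[R]_N) i :
  bary t ord0 i = (size t)%:R^-1 * \sum_(x <- t) x ord0 i.
Proof. by rewrite mxE summxE. Qed.

Lemma in_simplex_bary s : bary_closed (in_simplex s).
Proof.
move=> t t0 ts; have s0 : (0 : R) < (size t)%:R by rewrite ltr0n; case: (t) t0.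
split; [|split] => [i||i si].
- rewrite baryE mulr_ge0 ?invr_ge0 ?ler0n // big_seq sumr_ge0 // => x /ts[+ _]; exact.
- under eq_bigr do rewrite baryE.
  rewrite -mulr_sumr exchange_big /=.
  rewrite (eq_big_seq (fun=> 1)); last by move=> x /ts[_ []].
  by rewrite big_const_seq count_predT iter_addr addr0 mulVf ?gt_eqF.
- rewrite baryE big_seq big1 ?mulr0 // => x /ts[_ [_]]; exact.
Qed.

Lemma in_simplex_vertex s i : i \in s -> in_simplex s (vertex i).
Proof.
move=> si; split; [|split] => [j||j sj]; rewrite ?mxE ?ler0n //.
  rewrite (bigD1 i) //= mxE !eqxx big1 ?addr0 // => j ji.
  by rewrite mxE (negbTE ji) andbF.
by rewrite eqxx; case: eqP => // ji; rewrite ji si in sj.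
Qed.

Lemma in_simplex_le1 s x i : in_simplex s x -> x ord0 i <= 1.
Proof.
by move=> [x0 [<- _]]; rewrite (bigD1 i) //= lerDl sumr_ge0.
Qed.

Lemma in_simplexS s t x : s \subset t -> in_simplex s x -> in_simplex t x.
Proof.
move=> st [x0 [x1 xs]]; do 2 split=> //; move=> i it; apply: xs.
by apply: contra it; apply: (fintype.subsetP st).
Qed.

Lemma in_simplex_center t : t != finset.set0 -> in_simplex t (center t).
Proof.
move=> /set0Pn[i ti]; have t0 : (0 : R) < #|t|%:R by rewrite ltr0n (cardD1 i) ti.
split; [|split] => [j||j tj]; rewrite ?mxE.
- by case: ifP => _ //; rewrite invr_ge0 ltW.
- under eq_bigr do rewrite mxE.
  rewrite -big_mkcond /= sumr_const -[_^-1 *+ _]mulr_natl mulfV // gt_eqF //.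
- by rewrite (negbTE tj).
Qed.

Lemma norm_coord_le x i : `|x ord0 i| <= `|x|.
Proof. by rewrite [leRHS]/Num.norm /= mx_normrE; apply: (le_bigmax _ (fun ij => `|x ij.1 ij.2|) (ord0, i)). Qed.

Lemma norm_row_le x (d : R) : 0 <= d -> (forall i, `|x ord0 i| <= d) -> `|x| <= d.
Proof.
move=> d0 xd; rewrite [leLHS]/Num.norm /= mx_normrE; apply: bigmax_le => // -[j i] _ /=.
by rewrite (ord1 j).
Qed.

Lemma in_simplex_dist s t x y : in_simplex s x -> in_simplex t y -> `|x - y| <= 1.
Proof.
move=> xs yt; apply: norm_row_le => // i; rewrite !mxE ler_norml.
have := in_simplex_le1 i xs; have := in_simplex_le1 i yt.
by have [/(_ i)] := xs; have [/(_ i)] := yt; lra.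
Qed.

End SimplexPoints.

Lemma facets_containing N n (tau s : {set 'I_N}) : (#|s| = n.+1)%N -> tau \subset s ->
  [set s :\ i | i in s :\: tau]%SET =
  [set r : {set 'I_N} | [&& #|r| == n, tau \subset r & r \subset s]].
Proof.
move=> sn taus; apply/setP => r; rewrite inE; apply/imsetP/and3P.
  move=> [i]; rewrite inE => /andP[itau si ->]; split; last exact: subD1set.
    by have := cardsD1 i s; rewrite sn si add1n => -[<-].
  by rewrite subsetD1 itau taus.
move=> [/eqP rn taur rs].
have : (0 < #|s :\: r|)%N by rewrite cardsD (finset.setIidPr rs) sn rn subSnn.
rewrite card_gt0 => /set0Pn[i]; rewrite inE => /andP[ir si].
exists i; first by rewrite inE si andbT; apply: contra ir; apply: (fintype.subsetP taur).
apply/eqP; rewrite eqEcard subsetD1 rs ir /=.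
by have := cardsD1 i s; rewrite sn si add1n rn => -[<-].
Qed.

Section RelativeSperner.
Local Open Scope nat_scope.
Variables (R : realType) (N n : nat) (A : {set {set 'I_N}}) (tau s0 : {set 'I_N}) (i0 : 'I_N).
Hypothesis cardA : forall s, s \in A -> #|s| = n.+1.
Hypothesis tauA : forall s, s \in A -> tau \subset s.
Hypothesis evenA : forall r : {set 'I_N}, #|r| = n -> tau \subset r ->
  ~~ odd #|[set s in A | r \subset s]|.
Hypotheses (s0A : s0 \in A) (i0tau : i0 \in tau).

(* Vertices outside [s0 :\ i0] get the label [n], the value of [index] on non-members. *)
Definition vlabel (i : 'I_N) : nat := index i (enum (s0 :\ i0)).

Let i0s0 : i0 \in s0. Proof. exact: (fintype.subsetP (tauA s0A)). Qed.

Let card_s0 : #|s0 :\ i0| = n.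
Proof. by have := cardsD1 i0 s0; rewrite (cardA s0A) i0s0 add1n => -[<-]. Qed.

Lemma vlabel_le i : vlabel i <= n.
Proof. by rewrite /vlabel -card_s0 cardE index_size. Qed.

Lemma full_vlabel (r : {set 'I_N}) : #|r| = n ->
  full vlabel n (enum r) = (r == s0 :\ i0).
Proof.
move=> rn; apply/idP/eqP => [|->]; last first.
  rewrite /full; have -> : map vlabel (enum (s0 :\ i0)) = iota 0 n; last exact: perm_refl.
  apply: (@eq_from_nth _ 0); first by rewrite size_map size_iota -cardE.
  move=> k; rewrite size_map => kn.
  rewrite (nth_map i0) // /vlabel index_uniq ?enum_uniq // nth_iota ?add0n //.
  by rewrite -card_s0 cardE.
move=> /perm_mem rP; apply/eqP; rewrite eqEcard rn card_s0 leqnn andbT.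
apply/fintype.subsetP => i ir.
have : vlabel i \in iota 0 n by rewrite -rP map_f // mem_enum.
by rewrite mem_iota add0n -card_s0 cardE index_mem mem_enum.
Qed.

Variable L : 'rV[R]_N -> nat.
Hypothesis Ln : forall s x, s \in A -> in_simplex s x -> L x < n.+1.
(** Sperner's boundary condition, imposed only on faces opposite a vertex of [tau]: these form the
    frontier of the star. *)
Hypothesis Lface : forall s i x, s \in A -> i \in tau -> in_simplex (s :\ i) x ->
  exists k, x ord0 k != 0%R /\ L x = vlabel k.

Notation pts := (map (@vertex R N)).
Notation sdk k m := (iter k (@sdc R 'rV[R]_N m)).

(** Sperner's lemma on one face. Cells only carry labels of vertices of [r], so none is full unless
    [r] is. If [r] is full, the parity passes to the boundary, where subdivision commutes with [bd]
    and induction applies, and then back to [r]. *)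
Lemma odd_full_face k m (r : seq 'I_N) : uniq r -> size r = m ->
  (forall x, in_simplex [set i in r] x -> exists j, x ord0 j != 0%R /\ L x = vlabel j) ->
  odd (count (full L m) (sdk k m [:: pts r])) = full vlabel m r.
Proof.
elim: m r => [|m IH] r ur sr rL.
  rewrite (size0nil sr) /=; have -> : sdk k 0 [:: [::]] = [:: [::]] by elim: k => //= k ->.
  by rewrite /full /=.
have szs : forall t, t \in [:: pts r] -> size t = m.+1.
  by move=> t; rewrite inE => /eqP->; rewrite size_map.
have ptsr : forall t, t \in [:: pts r] -> forall x, x \in t -> in_simplex [set i in r] x.
  move=> t; rewrite inE => /eqP-> x /mapP[i ir ->]; apply: in_simplex_vertex.
  by rewrite inE.
have labr s x : s \in sdk k m.+1 [:: pts r] -> x \in s -> L x \in map vlabel r.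
  move=> sk xs.
  have xr := iter_sdc_closed (@in_simplex_bary R N [set i in r]) szs ptsr sk xs.
  have [j [xj ->]] := rL x xr; apply: map_f.
  apply: contraNT xj => jr; apply/eqP.
  by case: xr => _ [_]; apply; rewrite inE.
have [rfull|rNfull] := boolP (full vlabel m.+1 r); last first.
  rewrite (eq_in_count (a2 := pred0)) ?count_pred0 // => s sk /=.
  apply: contraNF rNfull => /perm_mem sP.
  have sub : {subset iota 0 m.+1 <= map vlabel r}.
    by move=> j; rewrite -sP => /mapP[x xs ->]; apply: labr sk xs.
  have szr : size (map vlabel r) <= size (iota 0 m.+1) by rewrite size_map sr size_iota.
  rewrite /full perm_sym uniq_perm ?iota_uniq //.
    exact: leq_size_uniq (iota_uniq _ _) sub szr.
  by have [_] := uniq_min_size (iota_uniq _ _) sub szr.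
rewrite -odd_full_bdc; last first.
  move=> s sk; split; first exact: size_sdc szs sk.
  apply/allP => x xs; have := labr s x sk xs.
  by rewrite (perm_mem rfull) mem_iota.
rewrite (bd_sdc k szs) /= /lin /= cats0 iter_sdc_lin odd_count_lin bd_map count_map.
rewrite -rfull -(@odd_full_bd _ vlabel m r sr); last first.
  apply/allP => i ir; have : vlabel i \in map vlabel r by exact: map_f.
  by rewrite (perm_mem rfull) mem_iota.
congr odd; apply: eq_in_count => t tr /=; apply: IH.
- rewrite (bd_uniq ur) in tr; case/mapP: tr => i _ ->; exact: rem_uniq.
- by rewrite (size_bd tr) sr.
move=> x xt; apply: rL; apply: in_simplexS xt; apply/fintype.subsetP => i.
by rewrite !inE; apply: mem_bd.
Qed.

Definition base_chain : seq (seq 'rV[R]_N) := [seq pts (enum (s : {set 'I_N})) | s <- enum A].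

Lemma rem_enum (s : {set 'I_N}) i : rem i (enum s) = enum (s :\ i).
Proof.
rewrite rem_filter ?enum_uniq // /(enum _) -filter_predI; apply: eq_filter => j.
by rewrite /= !inE andbC.
Qed.

Lemma odd_sum (I : finType) (P : pred I) (F : I -> nat) :
  odd (\sum_(i | P i) F i) = \big[addb/false]_(i | P i) odd (F i).
Proof. exact: (big_morph odd oddD (erefl _)). Qed.

(** Facets that contain [tau] lie in an even number of members of [A] and cancel. Among the facets
    missing a vertex of [tau], only [s0 :\ i0] counts, and it arises once: [s :\ i = s0 :\ i0] with
    [i] in [tau] forces [i = i0] and [s = s0]. *)
Lemma odd_sum_facets (psi : {set 'I_N} -> nat) :
  (forall s i, s \in A -> i \in tau -> psi (s :\ i) = (s :\ i == s0 :\ i0)) ->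
  odd (\sum_(s in A) \sum_(i in s) psi (s :\ i)).
Proof.
move=> psiE.
under eq_bigr => s sA do rewrite (bigID (mem tau)) /=.
rewrite big_split /= oddD.
have -> : \sum_(s in A) \sum_(i in s | i \in tau) psi (s :\ i) = 1.
  rewrite (bigD1 s0) //= [X in _ + X]big1 ?addn0 => [|s /andP[sA ss0]].
    rewrite (bigD1 i0) /= ?i0s0 // psiE // eqxx big1 // => i /andP[/andP[is0 it] ii0].
    rewrite psiE //; case: eqP => // E.
    have : i \in s0 :\ i0 by rewrite !inE ii0.
    by rewrite -E !inE eqxx.
  rewrite big1 // => i /andP[si it]; rewrite psiE //; case: eqP => // E.
  have ii0 : i = i0.
    apply/eqP; apply: contraTT isT => ii0.
    have : i0 \in s :\ i by rewrite !inE eq_sym ii0 (fintype.subsetP (tauA sA)).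
    by rewrite E !inE eqxx.
  case/eqP: ss0; rewrite -(finset.setD1K si) E ii0 finset.setD1K //; exact: i0s0.
rewrite addTb.
have -> : \sum_(s in A) \sum_(i in s | i \notin tau) psi (s :\ i) =
  \sum_(r : {set 'I_N} | (#|r| == n) && (tau \subset r)) psi r * #|[set s in A | r \subset s]|.
  transitivity (\sum_(s in A) \sum_(r : {set 'I_N} | [&& #|r| == n, tau \subset r & r \subset s]) psi r).
    apply: eq_bigr => s sA.
    transitivity (\sum_(r in [set s :\ i | i in s :\: tau]) psi r); last first.
      by apply: eq_bigl => r; rewrite (facets_containing (cardA sA) (tauA sA)) inE.
    rewrite big_imset /=; last first.
      move=> i j; rewrite !inE => /andP[_ si] /andP[_ sj] E.
      have : j \notin s :\ i by rewrite E !inE eqxx.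
      by rewrite !inE sj andbT negbK => /eqP.
    by apply: eq_bigl => i; rewrite !inE andbC.
  rewrite (exchange_big_dep (fun r : {set 'I_N} => (#|r| == n) && (tau \subset r))) /=; last first.
    by move=> s r _ /and3P[-> ->].
  apply: eq_bigr => r /andP[rn rt]; rewrite -sum1dep_card big_distrr /=.
  by apply: eq_big => [s|s _]; rewrite ?rn ?rt ?muln1.
rewrite odd_sum big1 // => r /andP[/eqP rn taur].
by rewrite oddM (negbTE (evenA rn taur)) andbF.
Qed.

Lemma size_base_chain t : t \in base_chain -> size t = n.+1.
Proof.
by move=> /mapP[s]; rewrite mem_enum => sA ->; rewrite size_map -cardE cardA.
Qed.

Lemma in_base_chain k t : t \in sdk k n.+1 base_chain ->
  exists2 s, s \in A & forall x, x \in t -> in_simplex s x.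
Proof.
elim: k t => [|k IH] t /=.
  move=> /mapP[s]; rewrite mem_enum => sA ->; exists s => // x /mapP[i].
  by rewrite mem_enum => si ->; apply: in_simplex_vertex.
move=> /flatten_mapP[t' t'c tt']; have [s sA t's] := IH _ t'c.
exists s => //; apply: (sd_closed (@in_simplex_bary R N s) _ t's tt').
exact: (size_sdc size_base_chain t'c).
Qed.

Lemma odd_full_base_chain k : odd (count (full L n.+1) (sdk k n.+1 base_chain)).
Proof.
rewrite -odd_full_bdc; last first.
  move=> t tc; split; first exact: size_sdc size_base_chain tc.
  have [s sA ts] := in_base_chain tc; apply/allP => x /ts; exact: Ln sA.
rewrite (bd_sdc k size_base_chain) /= iter_sdc_lin odd_count_lin.
set phi := fun t => odd (count _ _); rewrite odd_count_lin count_map.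
pose psi (r : {set 'I_N}) := phi (pts (enum r)).
have -> : count (preim (fun s : {set 'I_N} => pts (enum s)) (fun t => odd (count phi (bd t)))) (enum A)
  = \sum_(s in A) odd (\sum_(i in s) psi (s :\ i)).
  rewrite -sum1_count big_enum_cond /= big_mkcondr; apply: eq_bigr => s sA.
  rewrite bd_map (bd_uniq (enum_uniq _)) !count_map -sum1_count.
  rewrite big_enum_cond /= big_mkcondr /= .
  set b := odd _; set c := odd _; suff -> : b = c by case: c.
  congr odd; apply: eq_bigr => i si /=; rewrite /psi rem_enum; by case: (phi _).
have psiE s i : s \in A -> i \in tau -> psi (s :\ i) = (s :\ i == s0 :\ i0).
  move=> sA it.
  have si : #|s :\ i| = n.
    have := cardsD1 i s; rewrite (cardA sA) (fintype.subsetP (tauA sA)) // add1n => -[->] //.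
  rewrite -(full_vlabel si) /psi /phi; apply: odd_full_face.
  - exact: enum_uniq.
  - by rewrite -cardE.
  - by move=> x xs; apply: (Lface sA it); apply: in_simplexS xs; apply/fintype.subsetP => j; rewrite inE mem_enum.
have : odd (\sum_(s in A) \sum_(i in s) psi (s :\ i)).
  by apply: (@odd_sum_facets psi) => s i sA it; rewrite psiE.
rewrite odd_sum => psi_odd; rewrite odd_sum.
by under eq_bigr do rewrite oddb.
Qed.

End RelativeSperner.

(** * Maps on a star with Sperner boundary values have a zero *)

Section Essential.
Local Open Scope classical_set_scope.
Variable R : realType.

Lemma compact_cluster_seq (V : normedModType R) (X : set V) (u : nat -> V) :
  compact X -> (forall k, X (u k)) ->
  exists2 x, X x & forall e : R, 0 < e -> forall k0, exists2 k, (k0 <= k)%N & `|u k - x| < e.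
Proof.
move=> cX Xu.
have [|x [Xx clx]] := cX (u @ \oo) _.
  by rewrite /= nbhs_simpl; exists 0%N => // k _; apply: Xu.
exists x => // e e0 k0.
have [|_ /= [[k /= k0k <-] ux]] := clx (u @` [set k | (k0 <= k)%N]) (ball x e) _ (nbhsx_ballx x e e0).
  by rewrite /= nbhs_simpl; exists k0 => // k /= k0k; exists k.
by exists k => //; move: ux; rewrite -ball_normE /= distrC.
Qed.

Definition cont_on (V W : normedModType R) (X : set V) (f : V -> W) :=
  forall x, X x -> forall e : R, 0 < e ->
  exists2 d : R, 0 < d & forall y, X y -> `|y - x| < d -> `|f y - f x| < e.

Definition star N (A : {set {set 'I_N}}) : set 'rV[R]_N :=
  [set x | exists2 s, s \in A & in_simplex s x].

Lemma compact_in_simplex N (s : {set 'I_N}) : compact [set x | @in_simplex R N s x].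
Proof.
apply: bounded_closed_compact.
  exists 1; split; first exact: num_real.
  move=> M M1 x xs; apply: norm_row_le; first by lra.
  move=> i; have := in_simplex_le1 i xs; have [/(_ i) + _] := xs => x0 x1.
  by rewrite ger0_norm //; lra.
have cc i : continuous (fun x : 'rV[R]_N => x ord0 i) by exact: coord_continuous.
rewrite (_ : mkset _ = (\bigcap_(i in [set: 'I_N]) ((fun x : 'rV[R]_N => x ord0 i) @^-1` [set r | 0 <= r]))
   `&` (((fun x : 'rV[R]_N => \sum_i x ord0 i) @^-1` [set r | r = 1])
   `&` (\bigcap_(i in [set i | i \notin s]) ((fun x : 'rV[R]_N => x ord0 i) @^-1` [set r | r = 0])))); last first.
  apply/seteqP; split => x /= [x0 [x1 xs]].
    by split=> [i _|]; [exact: x0|split=> // i /xs].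
  by split=> [i|]; [exact: x0|split=> // i /xs].
apply: closedI; [|apply: closedI].
- apply: closed_bigI => i _; apply: closed_comp; last exact: closed_ge.
  by move=> x _; apply: cc.
- apply: closed_comp; last exact: closed_eq.
  move=> x _; apply: (@continuous_big _ _ +%R 0); last by move=> i _; apply: cc.
  exact: (@add_continuous R^o).
- apply: closed_bigI => i _; apply: closed_comp; last exact: closed_eq.
  by move=> x _; apply: cc.
Qed.

Lemma compact_star N (A : {set {set 'I_N}}) : compact (star A).
Proof.
rewrite (_ : star A = \big[setU/set0]_(s in A) [set x | @in_simplex R N s x]).
  by apply: bigsetU_compact => s _; apply: compact_in_simplex.
apply/seteqP; split => x /=.
  by move=> [s sA xs]; rewrite (bigD1 s) //=; left.
by elim/big_ind: _ => [[]|S T HS HT [/HS|/HT]|s sA xs] //; exists s.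
Qed.

Lemma geometric_small (t e : R) : 0 <= t < 1 -> 0 < e -> exists k0, forall k, (k0 <= k)%N -> t ^+ k < e.
Proof.
move=> /andP[t0 t1] e0.
have := @cvg_expr R t; rewrite ger0_norm // => /(_ t1) /cvgr0Pnorm_lt /(_ e e0) [k0 _ H].
by exists k0 => k /H /=; rewrite ger0_norm // exprn_ge0.
Qed.

Variables (N n : nat) (A : {set {set 'I_N}}) (tau : {set 'I_N}).
Hypothesis cardA : forall s, s \in A -> #|s| = n.+1.
Hypothesis tauA : forall s, s \in A -> tau \subset s.
Hypothesis evenA : forall r : {set 'I_N}, #|r| = n -> tau \subset r ->
  ~~ odd #|[set s in A | r \subset s]|.
Hypotheses (A0 : A != finset.set0) (tau0 : tau != finset.set0).

Lemma essential : exists lab : 'I_N -> 'I_n.+1, forall u : 'I_n.+1 -> 'rV[R]_N -> R,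
  (forall j, cont_on (star A) (u j : _ -> R^o)) ->
  (forall x, star A x -> \sum_j u j x = 0) ->
  (forall x i j, star A x -> i \in tau -> x ord0 i = 0 ->
     (forall k, lab k = j -> x ord0 k = 0) -> u j x <= 0) ->
  exists2 x, star A x & forall j, u j x = 0.
Proof.
have [s0 s0A] := set0Pn _ A0; have [i0 i0t] := set0Pn _ tau0.
exists (fun i => inord (vlabel s0 i0 i)) => u uc usum ubd.
apply: contrapT => /forall2NP nz.
have lab_lt i : (vlabel s0 i0 i < n.+1)%N by rewrite ltnS (vlabel_le cardA tauA s0A i0t).
have pos x : star A x -> exists j, 0 < u j x.
  move=> Xx; apply: contrapT => /forallNP np; case: (nz x) => // -[] j.
  apply/eqP; rewrite -oppr_eq0; move: j (I).
  have np' j : 0 <= - u j x by rewrite oppr_ge0 leNgt; apply/negP.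
  by move=> j _; have := @psumr_eq0P _ _ predT (fun j => - u j x) (fun j _ => np' j);
    rewrite sumrN usum // oppr0 => /(_ erefl j isT)/eqP.
pose L x : nat := if [pick j | 0 < u j x] is Some j then j else 0%N.
have LE x : star A x -> exists2 j : 'I_n.+1, 0 < u j x & L x = j.
  move=> /pos[j uj]; rewrite /L; case: pickP => [j' uj'|/(_ j)]; first by exists j'.
  by rewrite uj.
have Ln s x : s \in A -> in_simplex s x -> (L x < n.+1)%N.
  by move=> sA xs; have [|j _ ->] := LE x; [exists s|].
have Lface s i x : s \in A -> i \in tau -> in_simplex (s :\ i) x ->
    exists k, x ord0 k != 0 /\ L x = vlabel s0 i0 k.
  move=> sA it xs; have Xx : star A x.
    by exists s => //; apply: in_simplexS xs; apply: subD1set.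
  have [j uj ->] := LE x Xx; apply: contrapT => /forallNP H.
  suff : u j x <= 0 by rewrite leNgt uj.
  apply: (ubd x i) => //; first by case: xs => _ [_]; apply; rewrite !inE eqxx.
  move=> k kj; apply/eqP; apply: contrapT => /negP xk; apply: (H k); split => //.
  by rewrite -kj inordK.
have fullk k := odd_full_base_chain cardA tauA evenA s0A i0t Ln Lface k.
have vk k : {v : 'I_n.+1 -> 'rV[R]_N | (forall j, star A (v j) /\ 0 < u j (v j)) /\
    forall i j, `|v i - v j| <= (1 - n.+1%:R^-1) ^+ k}.
  apply: cid.
  have : has (full L n.+1) (iter k (@sdc R 'rV[R]_N n.+1) (base_chain R A)).
    by rewrite has_count; move: (fullk k); case: count.
  move=> /hasP[t tk /perm_mem tL].
  have [s sA ts] := in_base_chain cardA tk.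
  have [v vP] : {v : 'I_n.+1 -> 'rV[R]_N & forall j, v j \in t /\ L (v j) = j}.
    apply: (@boolp.choice _ _ (fun (j : 'I_n.+1) (x : 'rV[R]_N) => x \in t /\ L x = j)) => j.
      have : (j : nat) \in map L t by rewrite tL mem_iota add0n leq0n ltn_ord.
    by move=> /mapP[x xt ->]; exists x.
  exists v; split=> [j|i j].
    have [vt Lv] := vP j; have Xv : star A (v j) by exists s => //; apply: ts.
    by split=> //; have [j' + +] := LE _ Xv; rewrite Lv => /[swap] /ord_inj <-.
  rewrite -[leRHS]mul1r; apply: (mesh_sdc (size_base_chain cardA) _ tk); [|exact: (vP i).1|exact: (vP j).1].
  move=> t' /mapP[s']; rewrite mem_enum => s'A -> x y /mapP[a + ->] /mapP[b + ->].
  by rewrite !mem_enum => as' bs'; apply: in_simplex_dist; apply: in_simplex_vertex; [exact: as'|exact: bs'].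
pose w k := sval (vk k) ord0.
have [x Xx xcl] := @compact_cluster_seq _ _ w (@compact_star _ A) (fun k => ((svalP (vk k)).1 ord0).1).
case: (nz x) => // -[] j; apply/eqP; rewrite -oppr_eq0; apply/eqP; move: j.
have ge0 j : 0 <= u j x.
  rewrite leNgt; apply/negP => uneg.
  have un : 0 < - u j x by rewrite oppr_gt0.
  have [d d0 dP] := uc j x Xx _ un.
  have d2 : 0 < d / 2 by lra.
  have th : 0 <= (1 - n.+1%:R^-1 : R) < 1.
    rewrite subr_ge0 ltrBlDr ltrDl invr_gt0 ltr0n andbT invf_le1 ?ltr0n //.
    by rewrite ler1n.
  have [k0 k0P] := geometric_small th d2.
  have [k k0k wk] := xcl _ d2 k0.
  have [vX vm] := svalP (vk k).
  have [Xv upos] := vX j.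
  have H := dP _ Xv.
  suff : `|sval (vk k) j - x| < d.
    by move=> /H; rewrite ltr_norml; lra.
  rewrite -(subrK (w k) (sval (vk k) j)) -addrA.
  apply: (le_lt_trans (ler_normD _ _)).
  by have := k0P k k0k; have := vm j ord0; rewrite -/(w k); lra.
move=> j; apply/eqP; rewrite oppr_eq0; apply/eqP.
exact: (@psumr_eq0P _ _ predT (fun j => u j x) (fun j _ => ge0 j) (usum x Xx) j isT).
Qed.

End Essential.

(** * Lipschitz approximation *)

Section CompactApproximation.
Local Open Scope classical_set_scope.
Variable R : realType.
Implicit Types V W : normedModType R.

(** Compactness makes the implication from [0 < a] to [0 < b] uniform: points violating every bound
    [k.+1%:R^-1] would accumulate where [a] is positive and [b] is not. *)
Lemma compact_lower_bound V (X : set V) (a b : V -> R) (eta : R) :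
  compact X -> cont_on X (a : V -> R^o) -> cont_on X (b : V -> R^o) ->
  (forall x, X x -> 0 < a x -> 0 < b x) -> 0 < eta ->
  exists2 nu : R, 0 < nu & forall x, X x -> eta <= a x -> nu <= b x.
Proof.
move=> cX ca cb ab eta0; apply: contrapT => /forall2NP H.
have [u uP] : {u : nat -> V & forall k, [/\ X (u k), eta <= a (u k) & b (u k) < k.+1%:R^-1]}.
  apply: (@boolp.choice _ _ (fun k y => [/\ X y, eta <= a y & b y < k.+1%:R^-1])) => k; case: (H k.+1%:R^-1) => [|/existsNP[x /not_implyP[Xx /not_implyP[ax bx]]]].
    by case; rewrite invr_gt0 ltr0n.
  by exists x; split=> //; rewrite ltNge; apply/negP.
have [x Xx xcl] := compact_cluster_seq cX (fun k => let: And3 h _ _ := uP k in h).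
have near (e d : R) : 0 < e -> 0 < d -> exists y, [/\ X y, `|y - x| < d, eta <= a y & b y < e].
  move=> e0 d0; have [k k0k uk] := xcl d d0 (Num.trunc e^-1).
  have [Xu au bu] := uP k; exists (u k); split=> //.
  apply: (lt_trans bu); rewrite invf_plt ?posrE ?ltr0n //.
  apply: (lt_le_trans (Num.Theory.truncnS_gt _)).
  by rewrite ler_nat ltnS.
have ax : 0 < a x.
  have e2 : 0 < eta / 2 by lra.
  have [d d0 dP] := ca x Xx _ e2.
  have [y [Xy yx ay _]] := near 1 d ltr01 d0.
  by have := dP y Xy yx; rewrite ltr_norml /=; lra.
have bx := ab x Xx ax.
have b2 : 0 < b x / 2 by lra.
have [d d0 dP] := cb x Xx _ b2.
have [y [Xy yx _ yb]] := near _ d b2 d0.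
by have := dP y Xy yx; rewrite ltr_norml /=; lra.
Qed.

(** Uniform continuity of [h] composed with the inverse of [f], obtained on [X * X] from the two
    distance functions. *)
Lemma uniform_inverse V W (X : set V) (f : V -> W) (h : V -> R) (del : R) :
  compact X -> cont_on X f -> {in X &, injective f} -> cont_on X (h : V -> R^o) -> 0 < del ->
  exists2 eta : R, 0 < eta &
    forall x x', X x -> X x' -> `|f x - f x'| < eta -> `|h x - h x'| < del.
Proof.
move=> cX cf fi ch del0.
have [|||||nu nu0 H] := @compact_lower_bound (V * V)%type (X `*` X)
  (fun z => `|h z.1 - h z.2|) (fun z => `|f z.1 - f z.2|) del.
- exact: compact_setX.
- move=> [x y] [/= Xx Xy] e e0; have e2 : 0 < e / 2 by lra.
  have [d d0 dP] := ch x Xx _ e2; have [d' d'0 d'P] := ch y Xy _ e2.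
  exists (Num.min d d'); first by rewrite lt_min d0.
  move=> [x' y'] [/= Xx' Xy']; rewrite prod_normE gt_max !lt_min /= => /andP[/andP[xx _] /andP[_ yy]].
  have := dP x' Xx' xx; have := d'P y' Xy' yy => /= A B.
  apply: (le_lt_trans (ler_dist_dist _ _)).
  rewrite (_ : _ - _ = (h x' - h x) - (h y' - h y)); last by ring.
  by apply: (le_lt_trans (ler_normB _ _)); lra.
- move=> [x y] [/= Xx Xy] e e0; have e2 : 0 < e / 2 by lra.
  have [d d0 dP] := cf x Xx _ e2; have [d' d'0 d'P] := cf y Xy _ e2.
  exists (Num.min d d'); first by rewrite lt_min d0.
  move=> [x' y'] [/= Xx' Xy']; rewrite prod_normE gt_max !lt_min /= => /andP[/andP[xx _] /andP[_ yy]].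
  have := dP x' Xx' xx; have := d'P y' Xy' yy => /= A B.
  apply: (le_lt_trans (ler_dist_dist _ _)).
  rewrite (_ : _ - _ = (f x' - f x) - (f y' - f y)); last by rewrite !opprD !opprK addrACA.
  by apply: (le_lt_trans (ler_normB _ _)); lra.
- move=> [x y] [/= Xx Xy]; rewrite !normr_gt0 !subr_eq0; apply: contra => /eqP fxy.
  by apply/eqP; congr h; apply: fi => //; rewrite inE.
- exact: del0.
exists nu => // x x' Xx Xx' fx; rewrite ltNge; apply/negP => hx.
by have := H (x, x') (conj Xx Xx') hx; rewrite /= leNgt fx.
Qed.

(* The approximation is the inf-convolution y |-> inf_x (h x + L |y - f x|). *)
Lemma lipschitz_approx V W (X : set V) (f : V -> W) (h : V -> R) (M del : R) :
  compact X -> X !=set0 -> cont_on X f -> {in X &, injective f} -> cont_on X (h : V -> R^o) ->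
  (forall x, X x -> `|h x| <= M) -> 0 < del ->
  exists L : R, exists g : W -> R, [/\ 0 <= L, forall y y', `|g y - g y'| <= L * `|y - y'|
    & forall x, X x -> `|g (f x) - h x| <= del].
Proof.
move=> cX [x0 Xx0] cf fi ch hM del0.
have [eta eta0 etaP] := uniform_inverse cX cf fi ch del0.
have M0 : 0 <= M by apply: le_trans (hM x0 Xx0).
(* Points with images at distance at least [eta] then pay a penalty of at least [2 * M], which
   exceeds the oscillation of [h], so they cannot lower the infimum. *)
pose L := 2 * M / eta; have L0 : 0 <= L by rewrite /L divr_ge0 ?mulr_ge0 // ltW.
pose S y : set R := [set h x + L * `|y - f x| | x in X].
have hS y : has_inf (S y).
  split; first by exists (h x0 + L * `|y - f x0|), x0.
  exists (- M) => _ [x Xx <-]; have := hM x Xx; rewrite ler_norml => /andP[h1 _].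
  by have := mulr_ge0 L0 (normr_ge0 (y - f x)); lra.
have Sle y y' : inf (S y) <= inf (S y') + L * `|y - y'|.
  rewrite -lerBlDr; apply: lb_le_inf; first by case: (hS y').
  move=> _ [x Xx <-]; rewrite lerBlDr.
  apply: (@le_trans _ _ (h x + L * `|y - f x|)).
    by apply: ge_inf; [case: (hS y)|exists x].
  rewrite -addrA lerD2l -mulrDr ler_wpM2l // [leRHS]addrC.
  by rewrite -(subrKA y' y (- f x)) ler_normD.
exists L, (fun y => inf (S y)); split=> // [y y'|x Xx].
  by rewrite ler_norml lerBlDl Sle; have := Sle y' y; rewrite distrC; lra.
rewrite ler_norml; apply/andP; split.
  rewrite lerBrDl; apply: lb_le_inf; first by case: (hS (f x)).
  move=> _ [x' Xx' <-]; have [fxx|fxx] := ltP `|f x - f x'| eta.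
    have := etaP x x' Xx Xx' fxx; rewrite ltr_norml => /andP[_ hh].
    by have := mulr_ge0 L0 (normr_ge0 (f x - f x')); lra.
  have : 2 * M <= L * `|f x - f x'|.
    by rewrite -[leLHS](divfK (lt0r_neq0 eta0)) ler_wpM2l.
  have := hM x Xx; have := hM x' Xx'; rewrite !ler_norml; lra.
rewrite lerBlDl; apply: (@le_trans _ _ (h x)); last by lra.
apply: ge_inf; first by case: (hS (f x)).
by exists x => //; rewrite subrr normr0 mulr0 addr0.
Qed.

End CompactApproximation.

(** * Lipschitz images of a sphere miss a small value *)

Section AvoidSphere.
Variable R : realType.

Lemma norm_row_lt n (x : 'rV[R]_n) (d : R) : 0 < d -> (forall i, `|x ord0 i| < d) -> `|x| < d.
Proof.
move=> d0 xd; rewrite [ltLHS]/Num.norm /= mx_normrE; apply: bigmax_lt => // -[j i] _ /=.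
by rewrite (ord1 j).
Qed.

(* A sphere of dimension m is covered by O(M^m) cells of diameter O(1/M), so its Lipschitz
   image misses points of a grid with O(M^(m+1)) nodes and spacing O(1/M). *)
Lemma lipschitz_avoid m (g : 'I_m.+1 -> 'rV[R]_m.+1 -> R) (L eps del : R) (c : 'rV[R]_m.+1) :
  (forall j y y', `|g j y - g j y'| <= L * `|y - y'|) -> 0 < eps -> 0 < del ->
  exists2 v : 'I_m.+1 -> R, forall j, `|v j| <= del &
    forall y, `|y - c| = eps -> exists j, g j y != v j.
Proof.
move=> gL eps0 del0.
(* On a cell of side [2 * eps / (D * T)] each [g j] varies by less than the grid spacing
   [del / T]. *)
pose D := (Num.trunc (2 * eps * L / del)).+1.
have D0 : (0 : R) < D%:R by rewrite ltr0n.
have DL : 2 * eps * L < D%:R * del by rewrite -ltr_pdivrMr // Num.Theory.truncnS_gt.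
(* Chosen so that the [T ^ m.+1] grid nodes outnumber the cells, of which there are at most
   [2 * m.+1 * (2 * D * T) ^ m]. *)
pose T := (2 * m.+1 * (2 * D) ^ m).+1.
pose M := (D * T)%N.
have M0 : (0 : R) < M%:R by rewrite ltr0n.
have T0 : (0 : R) < T%:R by rewrite ltr0n.
pose val_ (k : {ffun 'I_m.+1 -> 'I_T}) j : R := del * (k j)%:R / T%:R.
apply: contrapT => /forall2NP H.
have [y yP] : {y : {ffun 'I_m.+1 -> 'I_T} -> 'rV[R]_m.+1 &
   forall k, `|y k - c| = eps /\ forall j, g j (y k) = val_ k j}.
  apply: (@boolp.choice _ _ (fun k y => `|y - c| = eps /\ forall j, g j y = val_ k j)) => k; case: (H (val_ k)) => [/existsNP[j]|/existsNP[y /not_implyP[yc /forallNP gy]]].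
    case; rewrite ger0_norm /val_; last by rewrite !mulr_ge0 ?invr_ge0 // ltW.
    by rewrite ler_pdivrMr //; apply: ler_wpM2l; [exact: ltW|rewrite ler_nat ltnW].
  by exists y; split=> // j; apply/eqP; apply: contrapT => /negP; apply: gy.
have face k : exists i, `|y k ord0 i - c ord0 i| = eps.
  have [yk _] := yP k; apply: contrapT => /forallNP no.
  suff : `|y k - c| < eps by rewrite yk ltxx.
  apply: norm_row_lt => // i; rewrite lt_neqAle; apply/andP; split.
    by rewrite !mxE; apply/eqP/no.
  by rewrite -yk norm_coord_le.
have coord k i : 0 <= (y k ord0 i - c ord0 i + eps) / (2 * eps) <= 1.
  have [yk _] := yP k; have := norm_coord_le (y k - c) i; rewrite yk !mxE ler_norml => /andP[h1 h2].
  have e2 : 0 < 2 * eps by lra.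
  by rewrite ler_pdivlMr // ler_pdivrMr // mul0r mul1r; lra.
pose z k i := Num.trunc ((y k ord0 i - c ord0 i + eps) / (2 * eps) * M%:R).
have zM k i : (z k i < M.+1)%N.
  have /andP[h0 h1] := coord k i.
  rewrite ltnS /z -(ler_nat R); apply: (@le_trans _ _ ((y k ord0 i - c ord0 i + eps) / (2 * eps) * M%:R)).
    by rewrite Num.Theory.truncn_le // mulr_ge0 // ltW.
  by rewrite ler_piMl // ltW.
have [face_ faceP] := boolp.choice face.
(* The norm is the sup norm, so the sphere is the surface of a cube: a cell is given by a face
   direction, its sign and rounded values of the other coordinates. *)
pose code k : 'I_m.+1 * bool * {ffun 'I_m -> 'I_M.+1} :=
  (face_ k, y k ord0 (face_ k) < c ord0 (face_ k), [ffun l => inord (z k (lift (face_ k) l))]).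
have code_inj : injective code.
  move=> k k' [ff sg /ffunP zz].
  have yy i : `|y k ord0 i - y k' ord0 i| <= 2 * eps / M%:R.
    have [l il|->] := unliftP (face_ k) i.
      have := zz l; rewrite !ffunE -ff -il => /(congr1 (@nat_of_ord _)); rewrite !inordK // => zl.
      have tr (a : R) : 0 <= a -> (Num.trunc a)%:R <= a < (Num.trunc a).+1%:R by move=> ?; exact: Num.Theory.truncn_itv.
      have /andP[a0 _] := coord k i; have /andP[b0 _] := coord k' i.
      have := tr _ (mulr_ge0 a0 (ltW M0)); have := tr _ (mulr_ge0 b0 (ltW M0)).
      rewrite -/(z k i) -/(z k' i) zl -natr1 => /andP[b1 b2] /andP[a1 a2].
      rewrite ler_norml -mulNr ler_pdivlMr // ler_pdivrMr //.
      have e2 : 0 < 2 * eps by lra.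
      set a := (_ / _) in a0 a1 a2; set b := (_ / _) in b0 b1 b2.
      have -> : y k ord0 i - y k' ord0 i = 2 * eps * (a - b) by rewrite /a /b; field; rewrite gt_eqF.
      by nra.
    have := faceP k; have := faceP k'; rewrite -ff => h' h.
    suff -> : y k ord0 (face_ k) = y k' ord0 (face_ k) by rewrite subrr normr0 divr_ge0 ?mulr_ge0 ?ltW.
    move: sg; rewrite -ff.
    by move: h h'; case: ltrP => a; case: ltrP => b // h h'; lra.
  apply/ffunP => j; apply/val_inj/eqP; rewrite -(eqr_nat R) /=.
  have : `|val_ k j - val_ k' j| < del / T%:R.
    have [_ gk] := yP k; have [_ gk'] := yP k'; rewrite -gk -gk'.
    apply: (le_lt_trans (gL j _ _)).
    have L0 : 0 <= L.
      have := le_trans (normr_ge0 _) (gL j (y k) c); have [-> _] := yP k.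
      by rewrite pmulr_lge0.
    apply: (@le_lt_trans _ _ (L * (2 * eps / M%:R))).
      rewrite ler_wpM2l //; apply: norm_row_le => [|i]; last by rewrite !mxE.
      by rewrite divr_ge0 ?mulr_ge0 ?ltW.
    rewrite /M natrM.
    rewrite (_ : L * _ = 2 * eps * L / D%:R / T%:R); last by field; rewrite !gt_eqF.
    by rewrite ltr_pM2r ?invr_gt0 // ltr_pdivrMr // [del * _]mulrC.
  rewrite /val_ -mulrBl -mulrBr normrM (gtr0_norm (_ : 0 < T%:R^-1)) ?invr_gt0 //.
  rewrite ltr_pM2r ?invr_gt0 // normrM (gtr0_norm del0) gtr_pMr // => lt1.
  rewrite -subr_eq0 -normr_eq0; move: lt1.
  rewrite -[(k j)%:R]/((k j : nat)%:Z%:~R) -[(k' j)%:R]/((k' j : nat)%:Z%:~R) -intrB -intr_norm.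
  rewrite (_ : 1 = 1%:~R) // ltr_int intr_eq0 => lt1.
  by lia.
have := leq_card code code_inj.
rewrite !card_prod card_bool !card_ffun !card_ord.
have MT : (M.+1 ^ m <= (2 * D * T) ^ m)%N.
  case: (m) => // m'; rewrite leq_exp2r //.
  by rewrite -mulnA mul2n -addnn -/M -addn1 leq_add2l muln_gt0.
move=> le1.
have : (T ^ m.+1 <= m.+1 * 2 * (2 * D * T) ^ m)%N.
  by apply: (leq_trans le1); rewrite leq_mul2l MT orbT.
rewrite (expnMn (2 * D)) mulnA (mulnC m.+1 2) expnS leq_mul2r expn_eq0 /=.
by rewrite leqNgt leqnn.
Qed.

End AvoidSphere.

(** * Invariance of domain at a mod 2 cycle point *)

Section InvarianceOfDomain.
Local Open Scope classical_set_scope.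
Variable R : realType.

(** * Cone coordinates on the star of a simplex *)

Section Coordinates.
Variables (N n : nat) (A : {set {set 'I_N}}) (tau : {set 'I_N}).
Implicit Types x y : 'rV[R]_N.

(** On the star this vanishes exactly on the frontier. The default 1 is harmless for nonempty [tau],
    as barycentric coordinates are at most 1. *)
Definition tmin x : R := \big[Num.min/1]_(i in tau) x ord0 i.

Lemma tmin_lipschitz x y : `|tmin x - tmin y| <= `|x - y|.
Proof.
apply: (big_ind2 (fun a b => `|a - b| <= `|x - y|)) => [|a b c d ab cd|i _].
- by rewrite subrr normr0.
- move: ab cd; rewrite !ler_norml /Num.min.
  by case: (ltP a c); case: (ltP b d); lra.
by rewrite (le_trans _ (norm_coord_le (x - y) i)) // !mxE.
Qed.

Lemma tmin_le x i : i \in tau -> tmin x <= x ord0 i.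
Proof. by move=> it; rewrite /tmin (bigD1 i) //= ge_min lexx. Qed.

Lemma tmin_ge0 x : (forall i, 0 <= x ord0 i) -> 0 <= tmin x.
Proof.
move=> x0; rewrite /tmin; elim/big_ind: _ => // a b a0 b0.
by rewrite le_min a0.
Qed.

Lemma tmin_attained x s : tau != finset.set0 -> in_simplex s x ->
  exists2 i, i \in tau & x ord0 i = tmin x.
Proof.
move=> /set0Pn[i0 i0t] xs.
have [[i it xi]|t1] : (exists2 i, i \in tau & x ord0 i = tmin x) \/ tmin x = 1.
  rewrite /tmin; elim/big_rec: _ => [|i a it [[j jt xj]|->]]; first by right.
    by left; rewrite /Num.min; case: ifP => _; [exists i|exists j].
  rewrite /Num.min; case: ifP => _; first by left; exists i.
  by right.
- by exists i.
have := tmin_le x i0t => le1; exists i0 => //; apply/eqP.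
by rewrite eq_le le1 t1 (in_simplex_le1 i0 xs).
Qed.

(** The star is the cone with apex [center tau] over its frontier: a point is the apex with weight
    [1 - slack] plus its excess, which has total mass [slack] and vanishes at some vertex of
    [tau]. *)
Definition excess x k : R := x ord0 k - (if k \in tau then tmin x else 0).

Definition slack x : R := 1 - #|tau|%:R * tmin x.

Lemma excess_ge0 x k : (forall i, 0 <= x ord0 i) -> 0 <= excess x k.
Proof.
by move=> x0; rewrite /excess; case: ifP => kt; rewrite ?subr0 // subr_ge0 tmin_le.
Qed.

Lemma sum_excess s x : in_simplex s x -> \sum_k excess x k = slack x.
Proof.
move=> [_ [x1 _]]; rewrite sumrB x1 -big_mkcond /= sumr_const.
by rewrite /slack mulr_natl.
Qed.

Lemma excess_lipschitz x y k : `|excess x k - excess y k| <= 2 * `|x - y|.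
Proof.
rewrite /excess; have := norm_coord_le (x - y) k; rewrite !mxE => h1.
have := tmin_lipschitz x y; move: h1; rewrite !ler_norml.
by case: ifP => _; have := normr_ge0 (x - y); lra.
Qed.

Lemma slack_lipschitz x y : `|slack x - slack y| <= N%:R * `|x - y|.
Proof.
rewrite /slack (_ : _ - _ = - (#|tau|%:R * (tmin x - tmin y))); last by ring.
rewrite normrN normrM ger0_norm //; apply: ler_pM => //; last exact: tmin_lipschitz.
by rewrite ler_nat (leq_trans (max_card _)) // card_ord.
Qed.

Variable lab : 'I_N -> 'I_n.+1.

(* The [u_coord j] sum to zero and vanish simultaneously only at the center of [tau]. *)
Definition u_coord (j : 'I_n.+1) x : R :=
  \sum_(k | lab k == j) excess x k - slack x / n.+1%:R.

Lemma sum_u_coord s x : in_simplex s x -> \sum_j u_coord j x = 0.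
Proof.
move=> xs; rewrite sumrB sumr_const card_ord -(sum_excess xs).
rewrite [X in X - _](_ : _ = \sum_k excess x k); last first.
  by rewrite (partition_big lab predT) //=.
by rewrite -mulrnAl -mulr_natr mulfK ?subrr.
Qed.

Lemma u_coord_lipschitz j x y : `|u_coord j x - u_coord j y| <= (3 * N)%:R * `|x - y|.
Proof.
rewrite /u_coord (_ : _ - _ = (\sum_(k | lab k == j) excess x k - \sum_(k | lab k == j) excess y k)
   - (slack x - slack y) / n.+1%:R); last by ring.
apply: (le_trans (ler_normB _ _)); rewrite -sumrB.
rewrite (_ : _ * _ = N%:R * (2 * `|x - y|) + N%:R * `|x - y|); last by rewrite natrM; ring.
apply: lerD.
  apply: (le_trans (ler_norm_sum _ _ _)).
  apply: (@le_trans _ _ (\sum_(k < N) 2 * `|x - y|)).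
    rewrite big_mkcond; apply: ler_sum => k _.
    by case: ifP => _; rewrite ?excess_lipschitz // mulr_ge0.
  by rewrite sumr_const card_ord [leRHS]mulr_natl.
rewrite normrM (ger0_norm (_ : 0 <= n.+1%:R^-1)) ?invr_ge0 // ler_pdivrMr ?ltr0n //.
apply: (le_trans (slack_lipschitz x y)); rewrite ler_peMr ?mulr_ge0 //.
by rewrite ler1n.
Qed.

Hypothesis cardA : forall s, s \in A -> #|s| = n.+1.
Hypothesis tauA : forall s, s \in A -> tau \subset s.
Hypothesis tau0 : tau != finset.set0.

Lemma slack_gt0 s x : in_simplex s x -> x != center R tau -> 0 < slack x.
Proof.
move=> xs xp; have [x0 [x1 _]] := xs.
have sl0 : 0 <= slack x by rewrite -(sum_excess xs) sumr_ge0 // => k _; apply: excess_ge0.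
rewrite lt_neqAle sl0 andbT; apply: contra xp => /eqP /esym sl.
have e0 k : excess x k = 0.
  apply: (@psumr_eq0P _ _ predT (excess x)) => // [i _|]; first exact: excess_ge0.
  by rewrite (sum_excess xs).
apply/eqP/rowP => k; rewrite mxE; have := e0 k; rewrite /excess; case: ifP => _; last by lra.
have t0 : (#|tau|%:R : R) != 0 by rewrite pnatr_eq0 cards_eq0.
move: sl; rewrite /slack => sl /subr0_eq ->; apply: (mulfI t0).
by rewrite divff //; lra.
Qed.

(** The excess lives on the n + 1 vertices of [s] and vanishes at one of them, so it meets at most n
    of the n + 1 labels. At a label it misses, [u_coord] is [- slack / (n + 1)]. *)
Lemma missing_label x : star A x -> exists j, forall k, lab k = j -> excess x k = 0.
Proof.
move=> [s sA xs]; have [i1 it xi] := tmin_attained tau0 xs.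
have si : i1 \in s by exact: (fintype.subsetP (tauA sA)).
set S := [set lab k | k in s :\ i1]%SET.
have S_lt : (#|S| < n.+1)%N.
  rewrite ltnS (leq_trans (leq_imset_card _ _)) //.
  by have := cardsD1 i1 s; rewrite (cardA sA) si add1n => -[<-].
have : (0 < #|finset.setC S|)%N by have := cardsC S; rewrite card_ord; lia.
rewrite card_gt0 => /set0Pn[j]; rewrite finset.in_setC => jS; exists j => k kj.
have [ki1|ki1] := eqVneq k i1; first by rewrite ki1 /excess it xi subrr.
have ks : k \notin s.
  by apply: contra jS => ks; apply/imsetP; exists k; rewrite ?inE ?ki1.
have [_ [_ /(_ k ks) xk]] := xs.
rewrite /excess xk; case: ifP => [kt|_]; last by rewrite subr0.
by rewrite (fintype.subsetP (tauA sA)) in ks.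
Qed.

End Coordinates.

Lemma cont_on_lipschitz (V W : normedModType R) (X : set V) (f : V -> W) (C : R) :
  0 <= C -> (forall x y, `|f x - f y| <= C * `|x - y|) -> cont_on X f.
Proof.
move=> C0 fC x _ e e0; have C1 : 0 < C + 1 by lra.
exists (e / (C + 1)); first by rewrite divr_gt0.
move=> y _; rewrite ltr_pdivlMr // => h; apply: (le_lt_trans (fC _ _)).
by apply: le_lt_trans h; rewrite mulrC; have := normr_ge0 (y - x); nra.
Qed.

Lemma cont_on_comp (V W U : normedModType R) (X : set V) (f : V -> W) (g : W -> U) :
  cont_on X f -> (forall x, X x -> {for f x, continuous g}) -> cont_on X (g \o f).
Proof.
move=> cf cg x Xx e e0.
have /nbhs_ballP[d /= d0 dP] : \forall y \near f x, `|g y - g (f x)| < e.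
  have := cg x Xx => /cvgrPdist_lt /(_ e e0); apply: filterS => y; by rewrite distrC.
have [d' d'0 d'P] := cf x Xx d d0.
exists d' => // y Xy yx; apply: dP; rewrite -ball_normE /= distrC; exact: d'P.
Qed.

Lemma cont_on_comp_lipschitz (V W U : normedModType R) (X : set V) (f : V -> W) (g : W -> U) (C : R) :
  0 <= C -> cont_on X f -> (forall x y, `|g x - g y| <= C * `|x - y|) ->
  cont_on X (fun x => g (f x)).
Proof.
move=> C0 cf gC x Xx e e0; have C1 : 0 < C + 1 by lra.
have [d d0 dP] := cf x Xx _ (divr_gt0 e0 C1).
exists d => // y Xy /(dP y Xy); rewrite ltr_pdivlMr // => h; apply: (le_lt_trans (gC _ _)).
by apply: le_lt_trans h; rewrite mulrC; have := normr_ge0 (f y - f x); nra.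
Qed.

Lemma cont_on_oppr_sum (V : normedModType R) (X : set V) (I : finType) (w : I -> V -> R) :
  (forall i, cont_on X (w i : _ -> R^o)) -> cont_on X ((fun x => - \sum_i w i x) : _ -> R^o).
Proof.
move=> cw x Xx e e0.
have e1 : 0 < e / #|I|.+1%:R by rewrite divr_gt0 // ltr0n.
have [d dP] : {d : I -> R & forall i, 0 < d i /\
    forall y, X y -> `|y - x| < d i -> `|w i y - w i x| < e / #|I|.+1%:R}.
  apply: (@boolp.choice _ _ (fun i d => 0 < d /\
    forall y, X y -> `|y - x| < d -> `|w i y - w i x| < e / #|I|.+1%:R)) => i.
  by have [d d0 dP] := cw i x Xx _ e1; exists d.
exists (\big[Num.min/1]_i d i).
  by elim/big_ind: _ => // [a b a0 b0|i _]; [rewrite lt_min a0|case: (dP i)].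
move=> y Xy yx; rewrite opprK addrC -sumrB.
apply: (@le_lt_trans _ _ (\sum_(i : I) e / #|I|.+1%:R)).
  apply: (le_trans (ler_norm_sum _ _ _)); apply: ler_sum => i _.
  rewrite distrC; have [_ H] := dP i; apply/ltW/H => //; apply: (lt_le_trans yx).
  by rewrite (bigD1 i) //= ge_min lexx.
rewrite sumr_const -[_ *+ #|_|]mulr_natr mulrAC ltr_pdivrMr ?ltr0n //.
by rewrite ltr_pM2l // ltr_nat.
Qed.

(* Pushes the ball of radius [eps] around [c] onto its boundary sphere. *)
Definition push (W : normedModType R) (c : W) (eps : R) (y : W) : W :=
  c + Num.max 1 (eps / `|y - c|) *: (y - c).

Lemma push_id (W : normedModType R) (c y : W) eps : 0 < eps -> eps <= `|y - c| -> push c eps y = y.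
Proof.
move=> e0 yc; rewrite /push max_l ?scale1r ?subrKC //.
by rewrite ler_pdivrMr ?mul1r //; apply: lt_le_trans yc.
Qed.

Lemma push_sphere (W : normedModType R) (c y : W) eps : y != c -> `|y - c| <= eps ->
  `|push c eps y - c| = eps.
Proof.
move=> yc ye; have y0 : 0 < `|y - c| by rewrite normr_gt0 subr_eq0.
rewrite /push addrAC subrr add0r max_r; last by rewrite ler_pdivlMr ?mul1r.
rewrite normrZ ger0_norm ?divfK ?gt_eqF //.
by rewrite divr_ge0 // ltW // (lt_le_trans y0).
Qed.

Lemma push_continuous (W : normedModType R) (c y : W) eps : y != c -> {for y, continuous (push c eps)}.
Proof.
move=> yc; have y0 : `|y - c| != 0 by rewrite normr_eq0 subr_eq0.
have sub : z - c @[z --> y] --> y - c.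
  by apply: cvgB; [apply: cvg_id|apply: cvg_cst].
have inv : (eps / `|z - c| : R^o) @[z --> y] --> (eps / `|y - c| : R^o).
  by apply: cvgM; [exact: cvg_cst|apply: cvgV => //; exact: cvg_norm].
have mx := @continuous_max R _ (fun=> 1) (fun z => eps / `|z - c|) y (cvg_cst _) inv.
rewrite /push; apply: (@cvgD R W); first exact: cvg_cst.
by apply: (@cvgZ R W _ _ _ (fun z => Num.max 1 (eps / `|z - c|)) (fun z => z - c)); [exact: mx|exact: sub].
Qed.

Section LocalOpenness.
Variables (N m : nat) (A : {set {set 'I_N}}) (tau : {set 'I_N}).
Local Notation n := m.+1.
Hypothesis cardA : forall s, s \in A -> #|s| = n.+1.
Hypothesis tauA : forall s, s \in A -> tau \subset s.
Hypothesis evenA : forall r : {set 'I_N}, #|r| = n -> tau \subset r ->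
  ~~ odd #|[set s in A | r \subset s]|.
Hypotheses (A0 : A != finset.set0) (tau0 : tau != finset.set0).
Variable f : 'rV[R]_N -> 'rV[R]_n.
Hypotheses (cf : cont_on (star A) f) (fi : {in star A &, injective f}).

Let p : 'rV[R]_N := center R tau.

Let Xp : star A p.
Proof.
have [s sA] := set0Pn _ A0; exists s => //.
exact: in_simplexS (tauA sA) (in_simplex_center R tau0).
Qed.

Lemma sum_lift_max k (F : 'I_k.+1 -> R) :
  \sum_j F j = \sum_i F (lift ord_max i) + F ord_max.
Proof.
rewrite big_ord_recr /=; congr (_ + _); apply: eq_bigr => i _; congr F.
by apply: val_inj; rewrite /= /bump leqNgt ltn_ord.
Qed.

Lemma slack_center : slack tau p = 0.
Proof.
have [i it pi] := tmin_attained tau0 (in_simplex_center R tau0).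
rewrite /slack -pi mxE it divff ?subrr // pnatr_eq0.
by rewrite cards_eq0.
Qed.

Let dist_p : cont_on (star A) ((fun x => `|f x - f p|) : _ -> R^o).
Proof.
apply: (cont_on_comp_lipschitz (C := 1) (g := fun y => `|y - f p| : R^o) _ cf) => // x y.
by rewrite mul1r; apply: (le_trans (ler_dist_dist _ _)); rewrite opprB subrKA.
Qed.

Let slack_cont : cont_on (star A) (slack tau : _ -> R^o).
Proof. by apply: (cont_on_lipschitz (C := N%:R)) => // x y; apply: slack_lipschitz. Qed.

(** Slack at least 1 means lying on the frontier, which avoids [p]; injectivity and compactness keep
    its image away from [f p]. *)
Lemma dist_lower_bound : exists2 eps : R, 0 < eps &
  forall x, star A x -> 1 <= slack tau x -> 2 * eps <= `|f x - f p|.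
Proof.
have [x Xx sl|nu nu0 H] := compact_lower_bound (@compact_star R N A) slack_cont dist_p _ ltr01.
  rewrite normr_gt0 subr_eq0; apply/eqP => fxp.
  have E : x = p by apply: fi; rewrite ?inE.
  by move: sl; rewrite E slack_center ltxx.
by exists (nu / 2) => [|x Xx /(H x Xx)]; lra.
Qed.

Lemma slack_lower_bound eps : 0 < eps -> exists2 nu : R, 0 < nu &
  forall x, star A x -> eps <= `|f x - f p| -> nu <= slack tau x.
Proof.
move=> eps0; apply: (compact_lower_bound (@compact_star R N A) dist_p slack_cont) eps0.
move=> x Xx d0; have [s sA xs] := Xx; apply: (slack_gt0 tau0 xs).
by apply: contraTneq d0 => ->; rewrite subrr normr0 ltxx.
Qed.

(** Suppose a value [c] near [f p] is missed. Then [f] can be pushed out of the ball around [c], and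
    a Lipschitz approximation of [u_coord] composed with the inverse of [f], shifted by a small [v],
    has no zero on the sphere. The resulting [u'] has no zero inside the ball by the choice of [v],
    and none outside, where it is close to [u_coord] and a missing label makes one coordinate
    negative. It still has Sperner boundary values, contradicting [essential]. *)
Lemma image_interior : exists2 e : R, 0 < e &
  forall y, `|y - f p| < e -> exists2 x, star A x & f x = y.
Proof.
have [lab labP] := @essential R N n A tau cardA tauA evenA A0 tau0.
have [eps eps0 epsP] := dist_lower_bound.
have e2 : 0 < eps / 2 by lra.
(* As [c] is within [eps / 2] of [f p], images [eps]-far from [c] are [eps / 2]-far from [f p],
   while the frontier, [2 * eps]-far from [f p], is mapped [eps]-far from [c]. *)
apply: contrapT => /forall2NP /(_ (eps / 2)) [//|/existsNP[c /not_implyP[cp /forall2NP cX]]].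
have fxc x : star A x -> f x != c.
  by move=> Xx; apply/eqP => E; case: (cX x).
have [nu nu0 nuP] := slack_lower_bound e2.
have far x : star A x -> eps <= `|f x - c| -> nu <= slack tau x.
  move=> Xx fx; apply: nuP => //.
  by have := ler_distD (f p) (f x) c; rewrite (distrC (f p)); lra.
have n2 : (0 : R) < n.+1%:R by rewrite ltr0n.
(* The last coordinate of [u'] accumulates n errors of size [2 * del], which must stay below
   [nu / (n + 1)]. *)
pose del := nu / (4 * n.+1%:R * n.+1%:R).
have del0 : 0 < del by rewrite divr_gt0 // !mulr_gt0.
pose u (i : 'I_n) := u_coord tau lab (lift ord_max i).
have uL j x y : `|u_coord tau lab j x - u_coord tau lab j y| <= (3 * N)%:R * `|x - y|.
  exact: u_coord_lipschitz.
have uM i x : star A x -> `|u i x| <= (3 * N)%:R + `|u i p|.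
  move=> [s sA xs]; rewrite -[u i x](subrK (u i p)); apply: (le_trans (ler_normD _ _)).
  rewrite lerD2r; apply: (le_trans (uL _ _ _)); rewrite ler_piMr //.
  exact: in_simplex_dist xs (in_simplex_center R tau0).
have [Lg LgP] : {Lg : 'I_n -> R * ('rV[R]_n -> R) & forall i, [/\ 0 <= (Lg i).1,
    forall y y', `|(Lg i).2 y - (Lg i).2 y'| <= (Lg i).1 * `|y - y'|
    & forall x, star A x -> `|(Lg i).2 (f x) - u i x| <= del]}.
  apply: (@boolp.choice _ _ (fun i (Lg : R * ('rV[R]_n -> R)) => [/\ 0 <= Lg.1,
    forall y y', `|Lg.2 y - Lg.2 y'| <= Lg.1 * `|y - y'|
    & forall x, star A x -> `|Lg.2 (f x) - u i x| <= del])) => i.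
  have [L [g HLg]] := lipschitz_approx (@compact_star R N A) (ex_intro _ p Xp) cf fi
    (cont_on_lipschitz (ler0n _ _) (uL (lift ord_max i))) (uM i) del0.
  by exists (L, g).
pose g i := (Lg i).2; pose L := \sum_i (Lg i).1.
have gL i y y' : `|g i y - g i y'| <= L * `|y - y'|.
  have [_ h _] := LgP i; apply: (le_trans (h y y')); rewrite ler_wpM2r //.
  rewrite /L (bigD1 i) //= lerDl sumr_ge0 // => k _; by have [] := LgP k.
have [v vdel vP] := lipschitz_avoid c gL eps0 del0.
have L0 : 0 <= L by rewrite sumr_ge0 // => k _; have [] := LgP k.
pose w i x := g i (push c eps (f x)) - v i.
(* The coordinates sum to zero, so n of them, a map into the same R^n as [f], determine the last. *)
pose u' (j : 'I_n.+1) x := if unlift ord_max j is Some i then w i x else - \sum_i w i x.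
have u'l i x : u' (lift ord_max i) x = w i x by rewrite /u' liftK.
have u'm x : u' ord_max x = - \sum_i w i x by rewrite /u' unlift_none.
have close x : star A x -> eps <= `|f x - c| -> forall j,
    `|u' j x - u_coord tau lab j x| < nu / n.+1%:R.
  move=> Xx fx.
  have cw i : `|w i x - u i x| <= 2 * del.
    rewrite /w push_id //; have [_ _ /(_ x Xx)] := LgP i; rewrite -/(g i) => h.
    rewrite (_ : _ - _ = (g i (f x) - u i x) - v i); last by ring.
    by apply: (le_trans (ler_normB _ _)); have := vdel i; lra.
  have dE : n.+1%:R * (2 * del) < nu / n.+1%:R.
    rewrite /del (_ : _ * _ = nu / n.+1%:R / 2); last by field; rewrite gt_eqF.
    by move: (divr_gt0 nu0 n2); set q := nu / _; lra.
  move=> j; case: (unliftP ord_max j) => [i|] ->.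
    rewrite u'l; apply: (le_lt_trans (cw i)); apply: le_lt_trans dE.
    by apply: ler_peMl; [lra|rewrite ler1n].
  have [s sA xs] := Xx; have := sum_u_coord tau lab xs; rewrite sum_lift_max => us.
  rewrite u'm (_ : - _ - _ = - \sum_i (w i x - u i x)); last first.
    have -> : u_coord tau lab ord_max x = - \sum_i u i x.
      by apply/eqP; rewrite -addr_eq0 addrC us.
    by rewrite [X in _ = - X]sumrB; ring.
  rewrite normrN; apply: le_lt_trans dE; apply: (le_trans (ler_norm_sum _ _ _)).
  apply: (@le_trans _ _ (\sum_(i < n) 2 * del)); first exact: ler_sum.
  rewrite sumr_const card_ord -[leLHS]mulr_natl; apply: ler_wpM2r; first by lra.
  by rewrite ler_nat.
have wc i : cont_on (star A) (w i : _ -> R^o).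
  have c1 : cont_on (star A) (push c eps \o f).
    by apply: cont_on_comp => // x Xx; apply: push_continuous; exact: fxc.
  apply: (cont_on_comp_lipschitz (g := fun y => g i y - v i : R^o) L0 c1) => y y'.
  by rewrite (_ : _ - _ - _ = g i y - g i y') ?gL //; ring.
have [|x Xx|x i j Xx it xi xk|x Xx u'0] := labP u'.
- move=> j; case: (unliftP ord_max j) => [i|] ->.
    by rewrite (_ : u' _ = w i) //; apply/funext => x; rewrite u'l.
  rewrite (_ : u' _ = fun x => - \sum_i w i x); last by apply/funext => x; rewrite u'm.
  exact: cont_on_oppr_sum.
- by rewrite sum_lift_max u'm (eq_bigr _ (fun i _ => u'l i x)) subrr.
- have [s sA xs] := Xx.
  have t0 : tmin tau x = 0.
    apply/eqP; rewrite eq_le -{1}xi tmin_le //= tmin_ge0 //; by case: xs.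
  have sl : slack tau x = 1 by rewrite /slack t0 mulr0 subr0.
  have fx : eps <= `|f x - c|.
    have := epsP x Xx; rewrite sl => /(_ (lexx _)).
    by have := ler_distD c (f x) (f p); lra.
  have := close x Xx fx j; rewrite ltr_norml => /andP[_].
  rewrite /u_coord big1 => [|k /eqP kj]; last first.
    by rewrite /excess xk // t0 if_same subrr.
  have : nu / n.+1%:R <= slack tau x / n.+1%:R.
    by rewrite ler_pM2r ?invr_gt0 //; exact: far.
  by set q := nu / _; set r := slack tau x / _; lra.
have [fx|fx] := leP eps `|f x - c|.
  have [j jP] := missing_label lab cardA tauA tau0 Xx.
  have := close x Xx fx j; rewrite u'0 ltr_norml => /andP[_].
  rewrite /u_coord big1 => [|k /eqP kj]; last by rewrite jP.
  have : nu / n.+1%:R <= slack tau x / n.+1%:R.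
    by rewrite ler_pM2r ?invr_gt0 //; exact: far.
  by set q := nu / _; set r := slack tau x / _; lra.
have [i /eqP[]] := vP _ (push_sphere (fxc x Xx) (ltW fx)).
by apply/eqP; rewrite -subr_eq0 -/(w i x) -u'l u'0.
Qed.

End LocalOpenness.

End InvarianceOfDomain.

(** * Stars in a triangulated manifold *)

Section TriangulatedManifold.
Local Open Scope classical_set_scope.
Variables (R : realType) (N m : nat) (K : {set {set 'I_N}}).
Local Notation n := m.+1.
Local Notation X := (@realization R N K).
Hypotheses (Kc : simplicial_complex K) (Km : closed_manifold X n).

Lemma within_cont_on (V W : normedModType R) (Y : set V) (f : V -> W) :
  {within Y, continuous f} -> cont_on Y f.
Proof.
move=> /subspace_continuousP cf x Yx e e0.
have /cvgrPdist_lt /(_ e e0) := cf x Yx; rewrite near_withinE => /nbhs_ballP[d /= d0 dP].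
exists d => // y Yy yx; rewrite distrC; apply: dP => //.
by rewrite -ball_normE /= distrC.
Qed.

Lemma cont_on_comp_on (V W U : normedModType R) (Y : set V) (Z : set W) (f : V -> W) (g : W -> U) :
  cont_on Y f -> (forall x, Y x -> Z (f x)) -> cont_on Z g -> cont_on Y (fun x => g (f x)).
Proof.
move=> cf YZ cg x Yx e e0; have [d d0 dP] := cg _ (YZ x Yx) e e0.
have [d' d'0 d'P] := cf x Yx d d0; exists d' => // y Yy yx.
by apply: dP; [exact: YZ|exact: d'P].
Qed.

Lemma support_sub s (x : 'rV[R]_N) : in_simplex s x -> [set i | x ord0 i != 0]%SET \subset s.
Proof.
move=> [_ [_ xs]]; apply/fintype.subsetP => i; rewrite inE; apply: contraNT => /xs ->.
by rewrite eqxx.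
Qed.

Lemma in_simplex_realization s (x : 'rV[R]_N) : s \in K -> in_simplex s x -> X x.
Proof.
move=> sK xs; have [x0 [x1 _]] := xs; split=> //; split=> //.
apply: (Kc.2 s) => //; first exact: support_sub.
apply: contra_eq_neq x1 => /setP S0; rewrite big1 ?(eq_sym 0) ?oner_neq0 // => i _.
by have := S0 i; rewrite !inE => /negbFE/eqP.
Qed.

Lemma in_simplex_segment s (p x : 'rV[R]_N) (t : R) : 0 <= t <= 1 ->
  in_simplex s p -> in_simplex s x -> in_simplex s (p + t *: (x - p)).
Proof.
move=> /andP[t0 t1] [p0 [p1 ps]] [x0 [x1 xs]]; split; [|split] => [i||i si].
- rewrite !mxE (_ : _ + _ = (1 - t) * p ord0 i + t * x ord0 i); last by ring.
  by rewrite addr_ge0 // mulr_ge0 // subr_ge0.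
- under eq_bigr do rewrite !mxE.
  by rewrite big_split /= -mulr_sumr sumrB x1 p1; ring.
- by rewrite !mxE ps // xs //; ring.
Qed.

Lemma simplex_nonempty s : s \in K -> s != finset.set0.
Proof. by move=> sK; apply: contraNneq Kc.1 => <-. Qed.

Lemma chart (tau : {set 'I_N}) : tau \in K ->
  exists (f : 'rV[R]_N -> 'rV[R]_n) (g : 'rV[R]_n -> 'rV[R]_N) (r : R),
  [/\ 0 < r, cont_on [set x | X x /\ `|x - center R tau| < r] f,
     continuous g, forall y, X (g y) /\ f (g y) = y
   & forall x, X x -> `|x - center R tau| < r -> g (f x) = x].
Proof.
move=> tK; have tau0 := simplex_nonempty tK.
have [U [f [g [oU [Up [cf [cg [fg gf]]]]]]]] := Km.2 _ (in_simplex_realization tK (in_simplex_center R tau0)).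
have /nbhs_ballP[r /= r0 rU] := open_nbhs_nbhs (conj oU Up).
have rU' x : `|x - center R tau| < r -> U x.
  by move=> xr; apply: rU; rewrite -ball_normE /= distrC.
exists f, g, r; split=> //.
- move=> x [Xx xr] e e0; have [d d0 dP] := within_cont_on cf (conj (rU' x xr) Xx) e0.
  by exists d => // y [Xy yr]; apply: dP; split=> //; exact: rU'.
- by move=> y; have [[_ ?] ?] := fg y.
- by move=> x Xx xr; apply: gf; split=> //; exact: rU'.
Qed.

(** The chart is only controlled near [center tau], so the star of [A] is first shrunk towards it by
    [phi]. By [image_interior] the shrunken star contains every nearby point of the realization, in
    particular a point [z] close to the center and interior to [sg]; the member of [A] containing
    [z] contains all of [sg]. *)
Lemma star_covers (A : {set {set 'I_N}}) (tau : {set 'I_N}) :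
  tau \in K -> A != finset.set0 -> A \subset K ->
  (forall s, s \in A -> #|s| = n.+1) -> (forall s, s \in A -> tau \subset s) ->
  (forall r : {set 'I_N}, #|r| = n -> tau \subset r -> ~~ odd #|[set s in A | r \subset s]|) ->
  forall sg, sg \in K -> tau \subset sg -> exists2 s, s \in A & sg \subset s.
Proof.
move=> tK A0 AK cardA tauA evenA sg sgK tsg; have tau0 := simplex_nonempty tK.
have [f [g [r [r0 cf cg fg gf]]]] := chart tK.
set p := center R tau in cf gf.
have pin (s : {set 'I_N}) : tau \subset s -> in_simplex s p.
  by move=> ts; apply: in_simplexS ts (in_simplex_center R tau0).
pose lam := Num.min 1 (r / 2).
have lam0 : 0 < lam by rewrite lt_min ltr01 /=; lra.
have lam1 : lam <= 1 by rewrite ge_min lexx.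
have lamr : lam < r by rewrite gt_min; apply/orP; right; lra.
pose phi (x : 'rV[R]_N) := p + lam *: (x - p).
have phis s x : s \in A -> in_simplex s x -> in_simplex s (phi x).
  by move=> sA xs; apply: in_simplex_segment => //; [rewrite ltW|apply: pin; exact: tauA].
have near (t : R) (s : {set 'I_N}) x : 0 < t -> tau \subset s -> in_simplex s x -> `|p + t *: (x - p) - p| <= t.
  move=> t0 ts xs; rewrite addrAC subrr add0r normrZ gtr0_norm //.
  by apply: ler_piMr; [exact: ltW|exact: in_simplex_dist xs (pin s ts)].
have phiX x : star A x -> X (phi x) /\ `|phi x - p| < r.
  move=> [s sA xs]; split.
    by apply: in_simplex_realization (phis s x sA xs); exact: (fintype.subsetP AK).
  by apply: le_lt_trans lamr; apply: (near _ s) => //; exact: tauA.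
have cphi : cont_on (star A) (fun x => f (phi x)).
  apply: cont_on_comp_on cf => //.
  apply: (cont_on_lipschitz (ltW lam0)) => x y.
  rewrite /phi opprD addrACA subrr add0r -scalerBr normrZ gtr0_norm //.
  by rewrite opprB addrA subrK.
have phi_inj : {in star A &, injective (fun x => f (phi x))}.
  move=> x y; rewrite !inE => /phiX[Xx xr] /phiX[Xy yr] /(congr1 g).
  rewrite !gf // => /addrI /scalerI; rewrite gt_eqF // => /(_ isT).
  exact: addIr.
have [e e0 eP] := image_interior cardA tauA evenA A0 tau0 cphi phi_inj.
rewrite {1}/phi -/p subrr scaler0 addr0 in eP.
have sg0 := simplex_nonempty sgK.
have pX : X p /\ `|p - p| < r.
  by split; [exact: in_simplex_realization (in_simplex_center R tau0)|rewrite subrr normr0].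
have [d d0 dP] := cf p pX e e0.
pose eta := Num.min lam (d / 2).
have eta0 : 0 < eta by rewrite lt_min lam0; lra.
have etal : eta <= lam by rewrite ge_min lexx.
have etad : eta < d by rewrite gt_min; apply/orP; right; lra.
pose z := p + eta *: (center R sg - p).
have csg := in_simplex_center R sg0.
have zs : in_simplex sg z.
  by apply: in_simplex_segment (pin _ tsg) csg; rewrite ltW //=; lra.
have zp : `|z - p| <= eta by exact: near csg.
have Xz : X z by exact: in_simplex_realization zs.
have zr : `|z - p| < r by lra.
have [x Xx fx] : exists2 x, star A x & f (phi x) = f z.
  by apply: eP; apply: dP => //; lra.
have [Xph phr] := phiX x Xx.
have phz : phi x = z by rewrite -(gf _ Xph phr) fx gf.
have [s sA xs] := Xx; exists s => //; apply/fintype.subsetP => k ksg.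
have [_ [_ ph0]] := phis s x sA xs; apply: contraT => /ph0; rewrite phz => zk.
have : 0 < z ord0 k.
  rewrite !mxE ksg (_ : _ + _ = (1 - eta) * p ord0 k + eta * #|sg|%:R^-1); last by rewrite !mxE; ring.
  have [/(_ k) pk _] := pin tau (fintype.subxx _).
  apply: ltr_wpDl; first by rewrite mulr_ge0 //; lra.
  by rewrite mulr_gt0 // invr_gt0 ltr0n card_gt0.
by rewrite zk ltxx.
Qed.

(** Otherwise a neighbourhood of [center tau] lies in the simplex [sg], which injects into R^n with
    one coordinate nonnegative throughout and zero at the center: the coordinate of a vertex outside
    [tau], or a spare one if [sg] has dimension below n. Composed with the inverse chart this
    contradicts openness. *)
Lemma star_not_in_simplex (tau sg : {set 'I_N}) : sg \in K -> tau != finset.set0 -> tau \subset sg ->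
  (#|sg| <= n.+1)%N -> (tau != sg) || (#|sg| <= n)%N ->
  exists2 rho, rho \in K & (tau \subset rho) && ~~ (rho \subset sg).
Proof.
move=> sgK tau0 tsg sgn tsg'; apply: contrapT => /forall2NP inside.
have tK : tau \in K by apply: (Kc.2 sg).
have {}inside rho : rho \in K -> tau \subset rho -> rho \subset sg.
  move=> rK tr; case: (inside rho) => [//|]; rewrite tr /=.
  by move=> /negP; rewrite negbK.
have [f [g [r [r0 cf cg fg gf]]]] := chart tK.
set p := center R tau in cf gf.
have pin : in_simplex tau p by exact: in_simplex_center.
have [k kt] := set0Pn _ tau0.
have ksg : k \in sg by exact: (fintype.subsetP tsg).
set y0 := f p.
have gy0 : g y0 = p.
  by rewrite gf // ?subrr ?normr0 //; apply: in_simplex_realization pin.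
have t0 : 0 < (#|tau|%:R^-1 : R) by rewrite invr_gt0 ltr0n card_gt0.
have close x : X x -> `|x - p| < #|tau|%:R^-1 -> in_simplex sg x.
  move=> [x0 [x1 xK]] xp; do 2 split=> //; move=> i isg; apply/eqP.
  apply: contraT => xi; suff : i \in sg by rewrite (negbTE isg).
  apply: (fintype.subsetP (inside _ xK _)); last by rewrite inE.
  apply/fintype.subsetP => j jt; rewrite inE; apply/eqP => xj.
  have := norm_coord_le (x - p) j; rewrite !mxE jt xj sub0r normrN gtr0_norm //.
  by lra.
have [d /= d0 dP] : exists2 d : R, 0 < d & forall y, `|y - y0| < d -> in_simplex sg (g y).
  have /cvgrPdist_lt /(_ _ t0) /nbhs_ballP[d /= d0 dP] := cg y0.
  exists d => // y yd; apply: close; first by case: (fg y).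
  by rewrite distrC -gy0; apply: dP; rewrite -ball_normE /= distrC.
(* Places a standard n-simplex in the ball of radius [d], with its center at [y0]. *)
pose l (x : 'rV[R]_n.+1) : 'rV[R]_n :=
  y0 + (d / 2) *: \row_i (x ord0 (lift ord_max i) - n.+1%:R^-1).
pose sg' := enum (sg :\ k).
have ssg' : size sg' = #|sg|.-1.
  by rewrite /sg' -cardE; have := cardsD1 k sg; rewrite ksg => ->.
have szn : (size sg' <= n)%N by rewrite ssg'; case: #|sg| sgn.
(* Coordinates sum to 1, so one may be dropped; dropping [k] in [tau] retains every coordinate
   outside [tau] as a candidate for [j0]. *)
pose prj (x : 'rV[R]_N) : 'rV[R]_n :=
  \row_(j < n) (if (j < size sg')%N then x ord0 (nth k sg' j) else 0).
have prj_inj x x' : in_simplex sg x -> in_simplex sg x' -> prj x = prj x' -> x = x'.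
  move=> [x0 [x1 xs]] [x'0 [x'1 x's]] /rowP pxx.
  have E i : i != k -> x ord0 i = x' ord0 i.
    move=> ik; have [isg|isg] := boolP (i \in sg); last by rewrite xs // x's.
    have ig : i \in sg' by rewrite mem_enum !inE ik.
    have ij : (index i sg' < n)%N by rewrite (leq_trans _ szn) // index_mem.
    by have := pxx (Ordinal ij); rewrite !mxE /= index_mem ig nth_index.
  apply/rowP => i; have [->|ik] := eqVneq i k; last exact: E.
  move: x1; rewrite -x'1 (bigD1 k) //= [in RHS](bigD1 k) //=.
  by rewrite (eq_bigr _ E) => /addIr.
have [j0 prj0 pj0] : exists2 j0, (forall x, in_simplex sg x -> 0 <= prj x ord0 j0)
    & prj p ord0 j0 = 0.
  case/orP: tsg' => [tsg'|sgn'].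
    have /fintype.properP[_ [i isg it]] : tau \proper sg by rewrite finset.properEneq tsg'.
    have ig : i \in sg'.
      by rewrite mem_enum !inE isg andbT; apply: contraNneq it => ->.
    have ij : (index i sg' < n)%N by rewrite (leq_trans _ szn) // index_mem.
    exists (Ordinal ij) => [x [x0 _]|]; rewrite !mxE /= index_mem ig nth_index //.
    by rewrite (negbTE it).
  have jm : (size sg' <= m)%N by rewrite ssg'; case: #|sg| sgn'.
  by exists ord_max => [x _|]; rewrite mxE /= ltnNge jm.
pose T : {set 'I_n.+1} := [set: 'I_n.+1]%SET.
(* With [T] in the role of [tau], no facet contains it and evenness is vacuous: [image_interior]
   becomes classical invariance of domain. *)
pose A : {set {set 'I_n.+1}} := [set T]%SET.
have T0 : T != finset.set0 by rewrite -card_gt0 cardsT card_ord.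
have sA x : star A x -> in_simplex T x.
  by move=> [s]; rewrite inE => /eqP->.
have lc : l (center R T) = y0.
  rewrite /l (_ : \row_i _ = 0) ?scaler0 ?addr0 //.
  by apply/rowP => i; rewrite !mxE inE cardsT card_ord subrr.
have ld x : star A x -> `|l x - y0| < d.
  move=> /sA xs; rewrite /l addrAC subrr add0r normrZ gtr0_norm; last by lra.
  have : `|\row_i (x ord0 (lift ord_max i) - n.+1%:R^-1)| <= 1 :> R.
    apply: norm_row_le => // i; rewrite mxE.
    have := in_simplex_dist xs (in_simplex_center R T0) => h.
    apply: le_trans h; have := norm_coord_le (x - center R T) (lift ord_max i).
    by rewrite !mxE inE cardsT card_ord.
  by nra.
have linj x x' : star A x -> star A x' -> l x = l x' -> x = x'.
  move=> /sA[_ [x1 _]] /sA[_ [x'1 _]] /addrI /scalerI; rewrite gt_eqF; last by lra.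
  move=> /(_ isT) /rowP xx'.
  have E i : x ord0 (lift ord_max i) = x' ord0 (lift ord_max i).
    by have := xx' i; rewrite !mxE => /addIr.
  apply/rowP => i; case: (unliftP ord_max i) => [j|] -> //.
  move: x1; rewrite -x'1 sum_lift_max [in RHS]sum_lift_max; under eq_bigr do rewrite E.
  exact: addrI.
have cF : cont_on (star A) (fun x => prj (g (l x))).
  apply: (@cont_on_comp_lipschitz R _ _ _ _ (fun x => g (l x)) prj 1) => //.
    apply: (@cont_on_comp R _ _ _ _ l g); last by move=> x _; exact: cg.
    apply: (cont_on_lipschitz (C := d / 2)) => [|x y]; first by lra.
    rewrite /l opprD addrACA subrr add0r -scalerBr normrZ ger0_norm; last by lra.
    rewrite ler_wpM2l //; first by lra.
    apply: norm_row_le => // i; rewrite !mxE opprB addrA subrK.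
    by apply: le_trans (norm_coord_le (x - y) (lift ord_max i)); rewrite !mxE.
  move=> x y; rewrite mul1r; apply: norm_row_le => // j; rewrite !mxE.
  case: ifP => _; last by rewrite subrr normr0.
  by apply: le_trans (norm_coord_le (x - y) (nth k sg' j)); rewrite !mxE.
have gin x : star A x -> in_simplex sg (g (l x)) by move=> /ld/dP.
have iF : {in star A &, injective (fun x => prj (g (l x)))}.
  move=> x x'; rewrite !inE => Ax Ax' /(prj_inj _ _ (gin x Ax) (gin x' Ax')) /(congr1 f).
  by rewrite !(fg _).2; apply: linj.
have [||||e e0 eP] := @image_interior R _ m A T _ _ _ _ T0 _ cF iF.
- by move=> s; rewrite inE => /eqP->; rewrite cardsT card_ord.
- by move=> s; rewrite inE => /eqP->.
- move=> s sn; rewrite finset.subTset => /eqP sT; move: sn; rewrite sT cardsT card_ord.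
  by move=> /eqP; rewrite eqn_leq ltnn.
- by apply/set0Pn; exists T; rewrite inE.
have [|x Ax] := eP (prj p - (e / 2) *: delta_mx ord0 j0).
  rewrite lc gy0 addrAC subrr add0r normrN normrZ gtr0_norm; last by lra.
  have : `|delta_mx ord0 j0 : 'rV[R]_n| <= 1.
    by apply: norm_row_le => // i; rewrite mxE normr_nat; case: (_ && _).
  by nra.
move=> /rowP /(_ j0); rewrite !mxE !eqxx mulr1 => E.
have := prj0 _ (gin x Ax); have := pj0; rewrite !mxE E => ->; lra.
Qed.

End TriangulatedManifold.

(** * From manifold to pseudomanifold *)

Section Pseudomanifold.
Variables (N m : nat) (K : {set {set 'I_N}}).
Local Notation n := m.+1.

Definition cofacets (t : {set 'I_N}) : {set {set 'I_N}} := [set s in simplices K n | t \subset s].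

(** Connectedness is phrased as constancy of invariant functions, the form in which a bounding chain
    of the dual cycle is refuted. *)
Record pseudomanifold : Prop := Pseudomanifold {
  pm_pure : forall s, s \in K -> exists2 t, t \in simplices K n & s \subset t;
  pm_two : forall t, t \in K -> #|t| = n -> #|cofacets t| = 2%N;
  pm_connected : forall (v : 'I_N) (h : {set 'I_N} -> bool),
    (forall t s s' : {set 'I_N}, #|t| = n -> v \in t -> s \in cofacets t -> s' \in cofacets t -> h s = h s') ->
    forall s s' : {set 'I_N}, s \in simplices K n -> s' \in simplices K n -> v \in s -> v \in s' -> h s = h s' }.

Variable R : realType.
Hypotheses (Kc : simplicial_complex K) (Km : closed_manifold (@realization R N K) n).

Lemma simplicesP k s : reflect (s \in K /\ #|s| = k.+1) (s \in simplices K k).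
Proof. by rewrite inE; apply: (iffP andP) => -[? /eqP]. Qed.

(* Two cofacets of [t] already form a mod 2 cycle around [t], so they exhaust its star. *)
Lemma two_cofacets (t : {set 'I_N}) x y s : #|t| = n -> x \notin t -> y \notin t -> x != y ->
  x |: t \in K -> y |: t \in K -> s \in K -> t \subset s -> (s \subset x |: t) || (s \subset y |: t).
Proof.
move=> tn xt yt xy xK yK sK ts.
have tK : t \in K.
  by apply: (Kc.2 (x |: t)) => //; [exact: finset.subsetU1|rewrite -card_gt0 tn].
have xty : x |: t != y |: t.
  apply: contraNneq xt => E; have : x \in y |: t by rewrite -E setU11.
  by rewrite in_setU1 (negbTE xy).
have cardA : forall s', s' \in [set x |: t; y |: t]%SET -> #|s'| = n.+1.
  by move=> s'; rewrite !inE => /orP[]/eqP->; rewrite cardsU1 ?xt ?yt tn.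
have tA : forall s', s' \in [set x |: t; y |: t]%SET -> t \subset s'.
  by move=> s'; rewrite !inE => /orP[]/eqP->; exact: finset.subsetU1.
have [|||s'] := star_covers Kc Km (A := [set x |: t; y |: t]%SET) tK _ _ cardA tA _ sK ts.
- by apply/set0Pn; exists (x |: t); rewrite !inE eqxx.
- by apply/fintype.subsetP => s'; rewrite !inE => /orP[]/eqP->.
- move=> r rn tr; have -> : r = t by apply/eqP; rewrite eq_sym eqEcard tr rn tn leqnn.
  have -> : [set s in [set x |: t; y |: t] | t \subset s]%SET = [set x |: t; y |: t]%SET.
    by apply/setP => s'; rewrite inE; apply: andb_idr; exact: tA.
  by rewrite cards2 xty.
by rewrite !inE => /orP[]/eqP-> ->; rewrite ?orbT.
Qed.

Lemma subset_of_card (I : finType) (s : {set I}) k : (k <= #|s|)%N ->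
  exists2 t : {set I}, t \subset s & #|t| = k.
Proof.
elim: k => [|k IH] ks; first by exists finset.set0; rewrite ?finset.sub0set ?cards0.
have [t ts tk] := IH (ltnW ks).
have /card_gt0P[x] : (0 < #|s :\: t|)%N by rewrite cardsD (finset.setIidPr ts) subn_gt0 tk.
rewrite inE => /andP[xt xs]; exists (x |: t); last by rewrite cardsU1 xt tk.
by apply/fintype.subsetP => i; rewrite !inE => /orP[/eqP->//|]; apply: (fintype.subsetP ts).
Qed.

(** A larger simplex would contain an n-set [t] and two further vertices [x], [y]; its face spanned
    by [t], [x] and [y] lies in neither [x |: t] nor [y |: t], against [two_cofacets]. *)
Lemma card_simplex_le s : s \in K -> (#|s| <= n.+1)%N.
Proof.
move=> sK; rewrite leqNgt; apply/negP => sn.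
have [|t ts tn] := @subset_of_card _ s n; first by rewrite ltnW // ltnW.
have : (1 < #|s :\: t|)%N by rewrite cardsD (finset.setIidPr ts) tn ltn_subRL addn1.
move=> /card_gt1P[x [y [+ + xy]]]; rewrite !inE => /andP[xt xs] /andP[yt ys].
have sub z : z \in s -> z |: t \subset s by move=> zs; rewrite finset.subUset finset.sub1set zs.
have inK (r : {set 'I_N}) : t \subset r -> r \subset s -> r \in K.
  move=> tr rs; apply: (Kc.2 s) => //; rewrite -card_gt0.
  by apply: leq_trans (subset_leq_card tr); rewrite tn.
have xytK : x |: (y |: t) \in K.
  apply: inK; last by rewrite finset.subUset finset.sub1set xs sub.
  by apply: fintype.subset_trans (finset.subsetU1 _ _); exact: finset.subsetU1.
have := two_cofacets tn xt yt xy (inK _ (finset.subsetU1 _ _) (sub x xs))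
   (inK _ (finset.subsetU1 _ _) (sub y ys)) xytK.
rewrite (fintype.subset_trans (finset.subsetU1 y t)) ?finset.subsetU1 // => /(_ isT).
rewrite !finset.subUset !finset.sub1set !inE !eqxx (negbTE xt) (negbTE yt) (negbTE xy) eq_sym (negbTE xy).
by rewrite andbF.
Qed.

Lemma pure s : s \in K -> exists2 t, t \in simplices K n & s \subset t.
Proof.
move=> sK.
have [t /maxsetP[/andP[tK st] tmax]] : exists t, maxset (fun t => (t \in K) && (s \subset t)) t.
  by have [t tP _] := @maxset_exists _ (fun t => (t \in K) && (s \subset t)) s (introT andP (conj sK (fintype.subxx s))); exists t.
exists t => //; apply/simplicesP; split=> //; apply/eqP; rewrite eqn_leq card_simplex_le //=.
rewrite ltnNge; apply/negP => tn.
have [|rho rK /andP[tr /negP[]]] := star_not_in_simplex Kc Km tK (simplex_nonempty Kc tK)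
  (fintype.subxx t) (card_simplex_le tK); first by rewrite tn orbT.
by rewrite (tmax rho) // rK (fintype.subset_trans st).
Qed.

Lemma cofacetsP (t s : {set 'I_N}) :
  reflect [/\ s \in K, #|s| = n.+1 & t \subset s] (s \in cofacets t).
Proof.
by rewrite inE; apply: (iffP andP) => [[/simplicesP[]]|[? ? ?]]; split=> //; apply/simplicesP.
Qed.

Lemma cofacet_setU1 (t s : {set 'I_N}) : #|t| = n -> s \in cofacets t ->
  exists2 x, x \notin t & s = x |: t.
Proof.
move=> tn /cofacetsP[sK sn ts].
have /card_gt0P[x] : (0 < #|s :\: t|)%N by rewrite cardsD (finset.setIidPr ts) sn tn subSnn.
rewrite inE => /andP[xt xs]; exists x => //; apply/eqP.
by rewrite eq_sym eqEcard finset.subUset finset.sub1set xs ts sn cardsU1 xt tn add1n leqnn.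
Qed.

Lemma card_cofacets t : t \in K -> #|t| = n -> #|cofacets t| = 2%N.
Proof.
move=> tK tn; have t0 := simplex_nonempty Kc tK.
have [s /simplicesP[sK sn] ts] := pure tK.
have sC : s \in cofacets t by apply/cofacetsP.
have [x xt sE] := cofacet_setU1 tn sC.
have [||rho rK /andP[tr rs]] := star_not_in_simplex Kc Km sK t0 ts.
- by rewrite sn.
- by apply/orP; left; apply/eqP => E; move: sn; rewrite -E tn => /eqP; rewrite eqn_leq ltnn andbF.
have [y yr ys] : exists2 y, y \in rho & y \notin s by exact/fintype.subsetPn.
have yt : y \notin t by apply: contra ys; apply: (fintype.subsetP ts).
have xy : x != y by apply: contraNneq ys => <-; rewrite sE setU11.
have yK : y |: t \in K.
  apply: (Kc.2 rho) => //; first by rewrite finset.subUset finset.sub1set yr.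
  by apply/set0Pn; exists y; rewrite setU11.
have xK : x |: t \in K by rewrite -sE.
suff -> : cofacets t = [set x |: t; y |: t]%SET.
  rewrite cards2; case: eqP => // E; have : x \in y |: t by rewrite -E setU11.
  by rewrite in_setU1 (negbTE xy) (negbTE xt).
apply/setP => r; rewrite in_set2; apply/idP/orP => [rC|].
  have /cofacetsP[rK' rn tr'] := rC.
  have := two_cofacets tn xt yt xy xK yK rK' tr'.
  move=> /orP[] sub; [left|right]; rewrite eqEcard sub rn cardsU1 tn ?xt ?yt add1n leqnn //.
by move=> [] /eqP->; apply/cofacetsP; split=> //; rewrite ?finset.subsetU1 // cardsU1 tn ?xt ?yt.
Qed.

Lemma manifold_pseudomanifold : pseudomanifold.
Proof.
split; [exact: pure|exact: card_cofacets|].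
move=> v h hinv s s' /simplicesP[sK sn] /simplicesP[s'K s'n] vs vs'.
(* A facet at [v] has both of its cofacets in this family or none, so incidences are even and
   [star_covers] places [s'] in it. *)
pose A := [set r in simplices K n | (v \in r) && (h r == h s)]%SET.
have v1 : [set v]%SET \in K.
  by apply: (Kc.2 s) => //; [rewrite finset.sub1set|apply/set0Pn; exists v; rewrite inE].
have AP r : reflect [/\ r \in K, #|r| = n.+1, v \in r & h r = h s] (r \in A).
  rewrite inE; apply: (iffP and3P) => [[/simplicesP[? ?] ? /eqP ?]//|[? ? ? ->]].
  by split=> //; apply/simplicesP.
have vs1 : [set v]%SET \subset s' by rewrite finset.sub1set.
have [||r /AP[]//|r /AP[_ _ vr _]|t tn vt|r /AP[rK rn vr hr]] :=
    star_covers Kc Km (A := A) v1 _ _ _ _ _ s'K vs1.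
- by apply/set0Pn; exists s; apply/AP.
- by apply/fintype.subsetP => r /AP[].
- by rewrite finset.sub1set.
- have [tK|tK] := boolP (t \in K); last first.
    rewrite (_ : [set _ | _]%SET = finset.set0) ?cards0 //; apply/setP => r.
    rewrite inE finset.in_set0; apply/negP => /andP[/AP[rK _ _ _] tr]; case/negP: tK.
    by apply: (Kc.2 r) => //; rewrite -card_gt0 tn.
  have vt' : v \in t by rewrite -finset.sub1set.
  have [hA|hA] := boolP [exists r in cofacets t, h r == h s].
    have /existsP[r0 /andP[r0C /eqP r0s]] := hA.
    rewrite (_ : [set _ | _]%SET = cofacets t) ?card_cofacets //; apply/setP => r.
    rewrite inE; apply/andP/idP => [[/AP[rK rn _ _] tr]|rC]; first by apply/cofacetsP.
    have /cofacetsP[rK rn tr] := rC; split=> //; apply/AP; split=> //.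
      exact: (fintype.subsetP tr).
    by rewrite -r0s; apply: (hinv t).
  rewrite (_ : [set _ | _]%SET = finset.set0) ?cards0 //; apply/setP => r.
  rewrite inE finset.in_set0; apply/negP => /andP[/AP[rK rn _ hr] tr]; case/negP: hA.
  by apply/existsP; exists r; rewrite hr eqxx andbT; apply/cofacetsP.
move=> sr; have -> : s' = r by apply/eqP; rewrite eqEcard sr s'n rn leqnn.
by rewrite hr.
Qed.

End Pseudomanifold.

(** * Mod 2 cocycles and their dual cycles *)

Section Mod2Sums.

(** [bool] serves as the field F_2, with exclusive or as addition; parities of cardinals become sums
    in it. *)
Lemma odd_cardE (T : finType) (A : {set T}) (Q : pred T) :
  odd #|[set x in A | Q x]| = \sum_(x in A) (Q x : bool).
Proof.
rewrite -sum1dep_card (big_morph odd oddD (erefl _)) big_mkcondr /=.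
by apply: eq_bigr => x _; case: (Q x).
Qed.

Lemma sum_mem_bool (T : finType) (P A : pred T) (F : T -> bool) :
  \sum_(x | P x && A x) F x = \sum_(x | P x) (A x * F x : bool).
Proof. by rewrite big_mkcondr; apply: eq_bigr => x _; case: (A x). Qed.

Variables (N : nat) (K : {set {set 'I_N}}).

Lemma boundaryE k (c : {set {set 'I_N}}) t :
  (t \in boundary K k.+1 c) = (t \in simplices K k) && \sum_(s in c) (t \subset s : bool).
Proof. by rewrite !inE odd_cardE andbA. Qed.

(** Boundaries are the row space of the incidence matrix [B]. As [z] is outside it, some column of
    [cokermx B], a functional killing all rows, is nonzero on [z]. *)
Lemma exists_cocycle k (z : {set {set 'I_N}}) :
  z \subset simplices K k -> ~ is_boundary_mod2 K k z ->
  exists2 phi : {set 'I_N} -> bool,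
    forall t, t \in simplices K k.+1 -> \sum_(e in simplices K k | e \subset t) phi e = 0
    & \sum_(e in z) phi e = 1.
Proof.
move=> zK znb.
pose S := {set 'I_N}; pose M := #|{: S}|.
pose B : 'M[bool]_(M, M) := \matrix_(i, j)
  [&& enum_val i \in simplices K k.+1, enum_val j \in simplices K k & enum_val j \subset enum_val i].
pose w : 'rV[bool]_M := \row_j (enum_val j \in z).
have BE i e : B i (enum_rank e) =
    [&& enum_val i \in simplices K k.+1, e \in simplices K k & e \subset enum_val i].
  by rewrite mxE enum_rankK.
have reidx (F : S -> bool) : \sum_(j < M) F (enum_val j) = \sum_(e : S) F e.
  by rewrite (reindex (@enum_val S predT)) //=; apply: onW_bij; exact: enum_val_bij.
have : ~~ (w <= B)%MS.
  apply/negP => /submxP[D wD]; apply: znb.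
  pose d := [set s in simplices K k.+1 | D ord0 (enum_rank s)].
  exists d; split; first by apply/fintype.subsetP => s; rewrite inE => /andP[].
  apply/setP => t; rewrite boundaryE.
  have := congr1 (fun A : 'rV_M => A ord0 (enum_rank t)) wD; rewrite !mxE enum_rankK => ->.
  under [RHS]eq_bigr do rewrite BE.
  have -> : \sum_(i < M) D ord0 i * [&& enum_val i \in simplices K k.+1, t \in simplices K k & t \subset enum_val i]
    = \sum_(s : S) (D ord0 (enum_rank s) * [&& s \in simplices K k.+1, t \in simplices K k & t \subset s] : bool).
    by rewrite -reidx; apply: eq_bigr => i _; rewrite enum_valK.
  case: (t \in simplices K k) => /=; last first.
    by rewrite big1 // => s _; rewrite andbF mulr0.
  rewrite big_mkcond; apply: eq_bigr => s _; rewrite inE.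
  by case: (s \in simplices K k.+1); case: (D _ _).
rewrite submxE => /eqP wB.
have [j wj] : exists j, (w *m cokermx B) ord0 j != 0.
  apply: contrapT => /forallNP H; apply: wB; apply/rowP => j; rewrite [RHS]mxE.
  by apply/eqP; apply: contrapT => /negP; exact: H.
pose C := cokermx B.
exists (fun e => C (enum_rank e) j).
  move=> t tK; have := congr1 (fun A : 'M[bool]_(M, M) => A (enum_rank t) j) (mulmx_coker B).
  rewrite !mxE => E; rewrite -[RHS]E big_mkcond -reidx; apply: eq_bigr => i _.
  have := BE (enum_rank t) (enum_val i); rewrite enum_valK enum_rankK tK /= => ->.
  by case: ifP => _; rewrite ?mul1r ?mul0r.
have : (w *m C) ord0 j = 1 by move: wj; rewrite /C; case: (_ ord0 j).
rewrite mxE => E; rewrite -[RHS]E big_mkcond -reidx; apply: eq_bigr => i _; rewrite enum_valK.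
have -> : w ord0 i = (enum_val i \in z) by rewrite mxE.
by case: ifP => _; rewrite ?mul1r ?mul0r.
Qed.

End Mod2Sums.

(** * The cycle of facets dual to a cocycle *)

Section DualCycle.
Variables (N m : nat) (K : {set {set 'I_N}}).
Local Notation n := m.+1.
Hypotheses (Kc : simplicial_complex K) (Kp : pseudomanifold m K).
Variable a : 'I_N -> 'I_N -> bool.
Hypothesis a_cocycle : forall s u v w, s \in K -> u \in s -> v \in s -> w \in s ->
  a u v + a v w = a u w.
Hypothesis a_nontrivial : forall F : 'I_N -> bool,
  exists u v, [set u; v]%SET \in K /\ a u v != F u + F v.

Lemma a_diag s u : s \in K -> u \in s -> a u u = 0.
Proof. by move=> sK us; have := a_cocycle sK us us us; case: (a u u). Qed.

Lemma a_sym s u v : s \in K -> u \in s -> v \in s -> a u v = a v u.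
Proof.
move=> sK us vs; have := a_cocycle sK us vs us; rewrite (a_diag sK us).
by case: (a u v); case: (a v u).
Qed.

Variable i0 : 'I_N.
Definition base_vertex (s : {set 'I_N}) : 'I_N := odflt i0 [pick x in s].

Lemma base_vertex_in s : s \in K -> base_vertex s \in s.
Proof.
move=> sK; have [x xs] := set0Pn _ (simplex_nonempty Kc sK).
by rewrite /base_vertex; case: pickP => // /(_ x); rewrite xs.
Qed.

(** For the two cofacets s, s' of t the sum is the value of [a] along the path through the base
    vertices of s, t and s': the transported cocycle on the dual edge crossing t. *)
Definition dual_cycle : {set {set 'I_N}} :=
  [set t in simplices K m | \sum_(s in cofacets m K t) a (base_vertex s) (base_vertex t)].

Local Notation b := base_vertex.

Lemma card_intermediate (r s : {set 'I_N}) : #|r| = m -> #|s| = m.+2 -> r \subset s ->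
  #|[set t : {set 'I_N} | [&& #|t| == n, r \subset t & t \subset s]]| = 2%N.
Proof.
move=> rm sm rs.
rewrite -(facets_containing sm rs).
rewrite card_in_imset => [|i j]; first by rewrite cardsD (finset.setIidPr rs) rm sm -addn2 addKn.
rewrite !inE => /andP[_ si] /andP[_ sj] E.
have : j \notin s :\ i by rewrite E !inE eqxx.
by rewrite !inE sj andbT negbK => /eqP.
Qed.

Lemma sum_const_bool (T : finType) (A : {set T}) (x : bool) : \sum_(i in A) x = (odd #|A| && x).
Proof.
rewrite sumr_const; elim: #|A| => [|k IH]; first by rewrite mulr0n.
by rewrite mulrS IH /= {IH}; case: x; case: (odd k).
Qed.

(** Around a codimension 2 face [r], each term splits through the base vertex of [r]. The part
    depending on [t] occurs for both cofacets of [t], and the part depending on [s] for both facets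
    of [s] containing [r], so everything cancels. *)
Lemma dual_cycle_cycle : cycle_mod2 K m dual_cycle.
Proof.
split; first by apply/fintype.subsetP => t; rewrite inE => /andP[].
apply/setP => r; rewrite finset.in_set0; apply/negP; rewrite inE odd_cardE => /and3P[rK /eqP rm].
apply/negP; rewrite (_ : \sum_(_ in _) _ = 0) //.
rewrite (eq_bigl (fun t => (t \in simplices K m) && (\sum_(s in cofacets m K t) a (b s) (b t)))); last first.
  by move=> t; rewrite inE.
rewrite sum_mem_bool.
transitivity (\sum_(t in simplices K m | r \subset t) \sum_(s in cofacets m K t)
   (a (b s) (b r) + a (b t) (b r) : bool)).
  rewrite [RHS]big_mkcondr; apply: eq_bigr => t /simplicesP[tK tn].
  case: ifP => rt; last by rewrite mulr0.
  rewrite mulr1; apply: eq_bigr => s /cofacetsP[sK _ ts].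
  have bs := base_vertex_in sK.
  have bt := fintype.subsetP ts _ (base_vertex_in tK).
  have br := fintype.subsetP ts _ (fintype.subsetP rt _ (base_vertex_in rK)).
  by rewrite (a_sym sK bt br) (a_cocycle sK bs br bt).
under eq_bigr do rewrite big_split /=.
rewrite big_split /= [X in _ + X]big1 ?addr0; last first.
  by move=> t /andP[/simplicesP[tK tn] _]; rewrite sum_const_bool (pm_two Kp tK tn).
rewrite (exchange_big_dep (fun s => (s \in simplices K n) && (r \subset s))) /=; last first.
  move=> t s /andP[_ rt]; rewrite inE => /andP[-> ts].
  exact: fintype.subset_trans ts.
apply: big1 => s /andP[/simplicesP[sK sn] rs].
rewrite (eq_bigl (mem [set t : {set 'I_N} | [&& #|t| == n, r \subset t & t \subset s]])).
  by rewrite sum_const_bool card_intermediate.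
move=> t; rewrite [RHS]inE !inE sK sn eqxx /=.
case: (boolP (t \subset s)) => ts; rewrite ?andbF //= !andbT.
case: (boolP (#|t| == n)) => tn; rewrite ?andbF //= andbT.
suff -> : t \in K by [].
by apply: (Kc.2 s) => //; rewrite -card_gt0 (eqP tn).
Qed.

(** If [d] bounds the dual cycle, [h v] does not change across facets at [v], so it is constant on
    the n-simplices at [v]. Its value, as a function of [v], is a primitive of [a]. *)
Lemma dual_cycle_not_boundary : ~ is_boundary_mod2 K m dual_cycle.
Proof.
move=> [d [dK dc]].
pose h (v : 'I_N) (s : {set 'I_N}) : bool := (s \in d) + a (b s) v.
have hinv v (t s s' : {set 'I_N}) : #|t| = n -> v \in t -> s \in cofacets m K t -> s' \in cofacets m K t ->
    h v s = h v s'.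
  move=> tn vt sC s'C; have [->//|ss'] := eqVneq s s'.
  have /cofacetsP[sK sn ts] := sC; have /cofacetsP[s'K s'n ts'] := s'C.
  have tK : t \in K by apply: (Kc.2 s) => //; rewrite -card_gt0 tn.
  have CE : cofacets m K t = [set s; s']%SET.
    apply/eqP; rewrite eq_sym eqEcard (pm_two Kp tK tn) cards2 ss' leqnn andbT.
    by apply/fintype.subsetP => r; rewrite !inE => /orP[]/eqP->; have := sC; have := s'C; rewrite !inE.
  have tS : t \in simplices K m by apply/simplicesP.
  have : (t \in boundary K n d) = (t \in dual_cycle) by rewrite dc.
  rewrite boundaryE tS [t \in dual_cycle]inE tS /= CE.
  have -> : \sum_(r in d) (t \subset r : bool) = \sum_(r in [set s; s']%SET) (r \in d : bool).
    rewrite -CE; transitivity (\sum_(r | (r \in d) && (t \subset r)) (1 : bool)).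
      by rewrite sum_mem_bool; apply: eq_bigr => r _; rewrite mulr1.
    transitivity (\sum_(r | (r \in cofacets m K t) && (r \in d)) (1 : bool)); last first.
      by rewrite sum_mem_bool; apply: eq_bigr => r _; rewrite mulr1.
    apply: eq_bigl => r; rewrite [r \in cofacets _ _ _]inE andbC; case: (boolP (r \in d)) => rd; rewrite ?andbF //.
    by rewrite (fintype.subsetP dK) // andbT.
  rewrite !big_setU1 ?inE //= !big_set1 => E.
  have bt := base_vertex_in tK.
  have := a_cocycle sK (base_vertex_in sK) (fintype.subsetP ts _ bt) (fintype.subsetP ts _ vt).
  have := a_cocycle s'K (base_vertex_in s'K) (fintype.subsetP ts' _ bt) (fintype.subsetP ts' _ vt).
  rewrite /h => <- <-; move: E.
  by case: (s \in d); case: (s' \in d); case: (a (b s) (b t)); case: (a (b s') (b t)); case: (a (b t) v).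
pose top v := odflt finset.set0 [pick s in simplices K n | v \in s].
have topE v s : s \in simplices K n -> v \in s -> h v (top v) = h v s.
  move=> sS vs; rewrite /top; case: pickP => [s' /andP[s'S vs']|/(_ s)]; last by rewrite sS vs.
  exact: (pm_connected Kp (v := v) (h := h v) (hinv v)).
have [u [v [uvK]]] := a_nontrivial (fun v => h v (top v)).
have [s sS uvs] := pm_pure Kp uvK; have /simplicesP[sK _] := sS.
have us : u \in s by apply: (fintype.subsetP uvs); rewrite !inE eqxx.
have vs : v \in s by apply: (fintype.subsetP uvs); rewrite !inE eqxx orbT.
rewrite !(topE _ s) // /h -(a_cocycle sK us (base_vertex_in sK) vs).
rewrite (a_sym sK us (base_vertex_in sK)).
by case: (s \in d); case: (a _ u); case: (a _ v).
Qed.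

Definition bad_simplices : {set {set 'I_N}} :=
  [set s in simplices K n | [exists u in s, exists v in s, a u v]].

(** Each facet in the dual cycle has a bad cofacet, and an n-simplex has [m.+2] facets. *)
Lemma card_dual_cycle : (#|dual_cycle| <= m.+2 * #|bad_simplices|)%N.
Proof.
apply: (@leq_trans #|\bigcup_(s in bad_simplices) [set s :\ x | x in s]|).
  apply: subset_leq_card; apply/fintype.subsetP => t; rewrite inE => /andP[/simplicesP[tK tn] ct].
  have [s sC ast] : exists2 s, s \in cofacets m K t & a (b s) (b t).
    apply: contrapT => /forall2NP H; move: ct; rewrite big1 // => s sC.
    by case: (H s) => //; case: (a _ _).
  have /cofacetsP[sK sn ts] := sC.
  apply/finset.bigcupP; exists s.
    rewrite inE; apply/andP; split; first by apply/simplicesP.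
    apply/existsP; exists (b s); rewrite base_vertex_in //=.
    by apply/existsP; exists (b t); rewrite ast andbT (fintype.subsetP ts) // base_vertex_in.
  have [x xt sE] := cofacet_setU1 tn sC; apply/imsetP; exists x; first by rewrite sE setU11.
  by rewrite sE setU1K.
rewrite mulnC -sum_nat_const.
apply: (big_ind2 (fun (A : {set {set 'I_N}}) k => (#|A| <= k)%N)) => [|A k A' k' Ak Ak'|s].
- by rewrite cards0.
- by rewrite (leq_trans _ (leq_add Ak Ak')) // cardsU leq_subr.
by rewrite inE => /andP[/simplicesP[_ <-] _]; apply: leq_imset_card.
Qed.

Lemma sys_le k c : nontrivial_cycle K k c -> (sys K k <= #|c|)%N.
Proof.
move=> /asboolP cn; rewrite /sys.
elim: (index_enum _) (mem_index_enum c) => // x s IH; rewrite inE big_cons => /orP[/eqP<-|/IH le1].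
  by rewrite cn geq_minl.
by case: ifP => // _; rewrite geq_min le1 orbT.
Qed.

Lemma sys_le_bad : (sys K m <= m.+2 * #|bad_simplices|)%N.
Proof.
apply: leq_trans card_dual_cycle; apply: sys_le.
by split; [exact: dual_cycle_cycle|exact: dual_cycle_not_boundary].
Qed.

End DualCycle.

(** * Periods of a cocycle along edge walks *)

Section ClosedWalks.
Variables (N : nat) (K : {set {set 'I_N}}).
Hypothesis Kc : simplicial_complex K.
Variable phi : {set 'I_N} -> bool.
Hypothesis phi_closed :
  forall t, t \in simplices K 2 -> \sum_(e in simplices K 1 | e \subset t) phi e = 0.

Definition cochain (u v : 'I_N) : bool := (u != v) && phi [set u; v]%SET.

Lemma cochainC u v : cochain u v = cochain v u.
Proof. by rewrite /cochain eq_sym finset.setUC. Qed.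

Lemma cochain_cocycle s u v w : s \in K -> u \in s -> v \in s -> w \in s ->
  cochain u v + cochain v w = cochain u w.
Proof.
move=> sK us vs ws.
have [<-|uv] := eqVneq u v; first by rewrite {1}/cochain eqxx add0r.
have [<-|vw] := eqVneq v w; first by rewrite [X in _ + X]/cochain eqxx addr0.
have [<-|uw] := eqVneq u w.
  by rewrite [cochain v u]cochainC /cochain eqxx; case: (_ && _).
have wuv : w \notin [set u; v]%SET by rewrite !inE negb_or eq_sym uw eq_sym vw.
set t := [set u; v; w]%SET.
have tn : #|t| = 3%N by rewrite /t finset.setUC cardsU1 wuv cards2 uv.
have ts : t \subset s by rewrite !finset.subUset !finset.sub1set us vs ws.
have tK : t \in simplices K 2.
  by apply/simplicesP; split=> //; apply: (Kc.2 s) => //; rewrite -card_gt0 tn.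
have := phi_closed tK.
rewrite (eq_bigl (mem [set t :\ i | i in t :\: finset.set0])); last first.
  move=> e; rewrite (facets_containing tn (finset.sub0set t)) /= [RHS]inE finset.sub0set inE.
  case: (boolP (e \subset t)) => et; rewrite ?andbF ?andbT //.
  case: (boolP (#|e| == 2)) => en; rewrite ?andbF ?andbT //.
  apply: (Kc.2 s) => //; first exact: fintype.subset_trans ts.
  by rewrite -card_gt0 (eqP en).
rewrite finset.setD0 big_imset /=; last first.
  move=> i j it jt E; have : j \notin t :\ i by rewrite E !inE eqxx.
  by rewrite in_setD1 jt andbT negbK => /eqP.
have tE : t = w |: (u |: [set v])%SET by rewrite /t finset.setUC.
rewrite tE big_setU1 /=; last by move: wuv; rewrite !inE.
rewrite big_setU1 /=; last by rewrite inE.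
rewrite big_set1 -tE (_ : t :\ w = [set u; v]%SET); last by rewrite /t finset.setUC setU1K.
rewrite (_ : t :\ u = [set v; w]%SET); last first.
  apply/setP => i; rewrite !inE; case: (eqVneq i u) => [->|] //=.
  by rewrite (negbTE uv) (negbTE uw).
rewrite (_ : t :\ v = [set u; w]%SET); last first.
  apply/setP => i; rewrite !inE; case: (eqVneq i v) => [->|_] /=; last by rewrite orbF.
  by rewrite eq_sym (negbTE uv) (negbTE vw).
rewrite /cochain uv vw uw /=.
by case: (phi _); case: (phi _); case: (phi _).
Qed.

Lemma sum_odd_mem (T : finType) (S : seq T) (g : T -> bool) :
  \sum_(e in [set e | odd (count_mem e S)]%SET) g e = \sum_(e <- S) g e.
Proof.
rewrite (eq_bigl (fun e => true && odd (count_mem e S))); last by move=> e; rewrite inE.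
rewrite sum_mem_bool; elim: S => [|x S IH] /=.
  by rewrite big_nil big1 // => e _; rewrite mul0r.
rewrite big_cons -IH (eq_bigr (fun e => ((x == e) * g e + odd (count_mem e S) * g e : bool))).
  rewrite big_split /= (bigD1 x) //= eqxx mul1r big1 ?addr0 // => e ex.
  by rewrite eq_sym (negbTE ex) mul0r.
by move=> e _; rewrite -mulrDl oddD oddb.
Qed.

Lemma sum_boundary k (d : {set {set 'I_N}}) (g : {set 'I_N} -> bool) : d \subset simplices K k.+1 ->
  (forall t, t \in simplices K k.+1 -> \sum_(e in simplices K k | e \subset t) g e = 0) ->
  \sum_(e in boundary K k.+1 d) g e = 0.
Proof.
move=> dK g0; rewrite (eq_bigl (fun e => (e \in simplices K k) && \sum_(s in d) (e \subset s : bool))); last first.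
  by move=> e; rewrite boundaryE.
rewrite sum_mem_bool; under eq_bigr do rewrite mulr_suml.
rewrite exchange_big big1 //= => s sd.
by rewrite -[RHS](g0 s (fintype.subsetP dK _ sd)) sum_mem_bool.
Qed.

Definition adj (u v : 'I_N) : bool := (u != v) && ([set u; v]%SET \in K).

Lemma adjC u v : adj u v = adj v u.
Proof. by rewrite /adj eq_sym finset.setUC. Qed.

Lemma adj_of_simplex s u v : s \in K -> u \in s -> v \in s -> u != v -> adj u v.
Proof.
move=> sK us vs uv; rewrite /adj uv; apply: (Kc.2 s) => //.
  by rewrite finset.subUset !finset.sub1set us.
by apply/set0Pn; exists u; rewrite !inE eqxx.
Qed.

Fixpoint wsum (x : 'I_N) p : bool := if p is y :: p' then cochain x y + wsum y p' else 0.

Fixpoint steps (x : 'I_N) p : seq {set 'I_N} :=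
  if p is y :: p' then [set x; y]%SET :: steps y p' else [::].

Lemma size_steps x p : size (steps x p) = size p.
Proof. by elim: p x => //= y p IH x; rewrite IH. Qed.

Lemma wsum_steps x p : path adj x p -> wsum x p = \sum_(e <- steps x p) phi e.
Proof.
elim: p x => [|y p IH] x /=; first by rewrite big_nil.
by move=> /andP[/andP[xy _] /IH ->]; rewrite big_cons /cochain xy.
Qed.

Lemma steps_edges x p e : path adj x p -> e \in steps x p -> e \in simplices K 1.
Proof.
elim: p x => //= y p IH x /andP[/andP[xy xyK] yp]; rewrite inE => /orP[/eqP->|]; last exact: IH yp.
by apply/simplicesP; rewrite cards2 xy.
Qed.

Lemma steps_ends x p v : path adj x p ->
  \sum_(e <- steps x p) (v \in e : bool) = ((v == x) : bool) + (v == last x p).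
Proof.
elim: p x => [|y p IH] x /=; first by rewrite big_nil; case: (v == x).
move=> /andP[/andP[xy _] /IH]; rewrite big_cons => ->; rewrite !inE.
have [->|vx] := eqVneq v x; first by rewrite (negbTE xy); case: (x == _).
by case: (v == y); case: (v == _).
Qed.

Lemma wsum_cat x p q : wsum x (p ++ q) = wsum x p + wsum (last x p) q.
Proof. by elim: p x => [|y p IH] x /=; rewrite ?add0r // IH addrA. Qed.

Lemma reverse_walk x p : path adj x p ->
  exists q, [/\ path adj (last x p) q, last (last x p) q = x, size q = size p
    & wsum (last x p) q = wsum x p].
Proof.
elim: p x => [|y p IH] x /=; first by exists [::].
move=> /andP[xy /IH[q [pq lq sq wq]]]; exists (q ++ [:: x]).
rewrite cat_path pq lq last_cat /= adjC xy size_cat sq addn1 wsum_cat wq lq /=.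
by rewrite addr0 addrC cochainC.
Qed.

(** The edges traversed an odd number of times form a cycle with at most [size p] edges and the same
    period. A nonzero period would make it homologically nontrivial, as [phi] vanishes on
    boundaries. *)
Lemma closed_walk x p : path adj x p -> last x p = x -> (size p < sys K 1)%N -> wsum x p = 0.
Proof.
move=> xp lx sp; apply/eqP; apply: contraTT sp => wn0; rewrite -leqNgt.
pose z := [set e | odd (count_mem e (steps x p))]%SET.
have mem_z e : e \in z -> e \in steps x p.
  by rewrite inE; apply: contraTT => /count_memPn ->.
have wz : \sum_(e in z) phi e != 0 by rewrite sum_odd_mem -wsum_steps.
apply: (@leq_trans #|z|); last first.
  rewrite -(size_steps x) (leq_trans _ (card_size _)) // subset_leq_card //.
  by apply/fintype.subsetP => e /mem_z.
apply: sys_le; split.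
  split; first by apply/fintype.subsetP => e /mem_z; apply: steps_edges.
  apply/setP => t; rewrite finset.in_set0; apply/negP; rewrite boundaryE => /andP[/simplicesP[_ /eqP/cards1P[v ->]]].
  under eq_bigr do rewrite finset.sub1set.
  by rewrite sum_odd_mem steps_ends // lx; case: (v == x).
by move=> [d [dK dz]]; case/eqP: wz; rewrite -dz; apply: sum_boundary.
Qed.

(** A coboundary sums to zero over [z], because each vertex lies on an even number of edges of the
    cycle. *)
Lemma cochain_nontrivial (z : {set {set 'I_N}}) : cycle_mod2 K 1 z -> \sum_(e in z) phi e = 1 ->
  forall F : 'I_N -> bool, exists u v, [set u; v]%SET \in K /\ cochain u v != F u + F v.
Proof.
move=> [zK zc] z1 F; apply: contrapT => /forallNP H.
have FE u v : [set u; v]%SET \in K -> cochain u v = F u + F v.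
  move=> uv; apply/eqP; apply: contrapT => /negP ne.
  by have /forallNP/(_ v) := H u; apply.
suff : \sum_(e in z) phi e = 0 by rewrite z1.
transitivity (\sum_(e in z) \sum_(v : 'I_N) ((v \in e) * F v : bool)).
  apply: eq_bigr => e ez; have /simplicesP[eK /eqP/cards2P[u [v [uv eE]]]] := fintype.subsetP zK _ ez.
  have := FE u v; rewrite -eE => /(_ eK); rewrite /cochain uv -eE /= => ->.
  rewrite -sum_mem_bool (eq_bigl (mem e)) // eE big_setU1 ?big_set1 //=.
  by rewrite inE.
rewrite exchange_big big1 //= => v _; rewrite -mulr_suml.
suff -> : \sum_(e in z) (v \in e : bool) = 0 by rewrite mul0r.
have [vK|vK] := boolP ([set v]%SET \in K).
  have : [set v]%SET \in boundary K 1 z = false by rewrite zc finset.in_set0.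
  rewrite boundaryE !inE vK cards1 /= => vz; rewrite -[RHS]vz.
  by apply: eq_bigr => e _; rewrite finset.sub1set.
apply: big1 => e ez; apply/negbTE; apply: contra vK => ve.
have /simplicesP[eK _] := fintype.subsetP zK _ ez.
by apply: (Kc.2 e) => //; [rewrite finset.sub1set|apply/set0Pn; exists v; rewrite inE].
Qed.

End ClosedWalks.

(** * Ball growing *)

Section BallGrowing.
Variables (R : realType) (N m : nat) (K : {set {set 'I_N}}).
Local Notation n := m.+1.
Hypothesis Kc : simplicial_complex K.
Variable phi : {set 'I_N} -> bool.
Hypothesis phi_closed :
  forall t, t \in simplices K 2 -> \sum_(e in simplices K 1 | e \subset t) phi e = 0.
Variable L : nat.
Hypothesis L_sys : (2 * L + 1 < sys K 1)%N.

Local Notation a := (cochain phi).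

Fixpoint graph_ball (W : {set 'I_N}) v r : {set 'I_N} :=
  if r is r'.+1 then
    graph_ball W v r' :|: [set w in W | [exists u in graph_ball W v r', adj K u w]]
  else [set v]%SET.

Lemma graph_ball_walk W v r w : w \in graph_ball W v r ->
  exists p, [/\ path (adj K) v p, last v p = w & (size p <= r)%N].
Proof.
elim: r w => [|r IH] w /=; first by rewrite inE => /eqP->; exists [::].
rewrite !inE => /orP[/IH[p [pp lp sp]]|/andP[_ /existsP[u /andP[/IH[p [pp lp sp]] uw]]]].
  by exists p; split=> //; apply: leqW.
exists (rcons p w); rewrite rcons_path pp lp uw last_rcons size_rcons.
by split.
Qed.

Lemma graph_ball_sub (W : {set 'I_N}) v r : v \in W -> graph_ball W v r \subset W.
Proof.
move=> vW; elim: r => [|r IH] /=; first by rewrite finset.sub1set.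
rewrite finset.subUset IH; apply/fintype.subsetP => w.
by rewrite inE => /andP[].
Qed.

Lemma graph_ball_center W v r : v \in graph_ball W v r.
Proof. by elim: r => [|r IH] /=; rewrite inE ?IH. Qed.

(** The period from [v] to [w] along walks of length at most [L]; two such walks close up to fewer
    than sys_1 edges, so by [potentialE] the choice is immaterial. *)
Definition potential (v w : 'I_N) : bool :=
  `[< exists p, [/\ path (adj K) v p, last v p = w, (size p <= L)%N & wsum phi v p] >].

Lemma potentialE v p : path (adj K) v p -> (size p <= L)%N ->
  potential v (last v p) = wsum phi v p.
Proof.
move=> vp sp; apply/idP/idP => [/asboolP[q [vq lq sq wq]]|wp]; last by apply/asboolP; exists p.
have [q' [pq' lq' sq' wq']] := reverse_walk phi vq.
have := closed_walk phi_closed (x := v) (p := p ++ q').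
rewrite cat_path vp -lq pq' last_cat -lq lq' size_cat sq' wsum_cat -lq wq' wq.
move=> /(_ isT erefl); case: (wsum _ _ p) => // H; suff : 0 + true = 0 :> bool by [].
by apply: H; apply: leq_ltn_trans L_sys; lia.
Qed.

(** Walks from [v] to [u] and to [w], closed by the edge between them, have at most [2 * L + 1]
    edges, whence the bound [L_sys]. *)
Lemma potential_cochain W v r s u w : (r <= L)%N -> s \in K -> u \in s -> w \in s ->
  u \in graph_ball W v r -> w \in graph_ball W v r -> a u w = potential v u + potential v w.
Proof.
move=> rL sK us ws; have [->|uw] := eqVneq u w.
  by rewrite /cochain eqxx; case: (potential v w).
move=> /graph_ball_walk[p [vp lp sp]] /graph_ball_walk[q [vq lq sq]].
rewrite -{2}lp -{2}lq !potentialE //; [|exact: leq_trans rL|exact: leq_trans rL].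
have [q' [pq' lq' sq' wq']] := reverse_walk phi vq.
rewrite lq in pq' lq' wq'.
have := closed_walk phi_closed (x := v) (p := p ++ w :: q').
rewrite cat_path vp lp /= (adj_of_simplex Kc sK us ws uw) pq' last_cat /= lq'.
rewrite size_cat /= sq' wsum_cat lp /= wq' => /(_ isT erefl) cw.
have {cw} : wsum phi v p + (a u w + wsum phi v q) = 0.
  by apply: cw; apply: leq_ltn_trans L_sys; lia.
by case: (wsum _ v p); case: (wsum _ v q); case: (a u w).
Qed.

Definition inside (W : {set 'I_N}) : {set {set 'I_N}} := [set s in simplices K n | s \subset W].

Definition meeting (W B : {set 'I_N}) : {set {set 'I_N}} :=
  [set s in inside W | [exists u in s, u \in B]].

Lemma meeting_ball W v r : meeting W (graph_ball W v r) \subset inside (graph_ball W v r.+1).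
Proof.
apply/fintype.subsetP => s; rewrite !inE -!andbA => /and4P[sK sn sW /existsP[u /andP[us uB]]].
rewrite sK sn /=; apply/fintype.subsetP => w ws; rewrite !inE.
have [<-|uw] := eqVneq u w; first by rewrite uB.
rewrite (fintype.subsetP sW) //=; apply/orP; right; apply/existsP; exists u.
by rewrite uB /= (adj_of_simplex Kc sK us ws uw).
Qed.

Lemma inside_meeting (W : {set 'I_N}) v r : v \in W ->
  inside (graph_ball W v r) \subset meeting W (graph_ball W v r).
Proof.
move=> vW; apply/fintype.subsetP => s; rewrite !inE => /andP[/andP[sK sn] sB].
rewrite sK sn (fintype.subset_trans sB (graph_ball_sub _ vW)) /=.
have [u us] := set0Pn _ (simplex_nonempty Kc sK).
by apply/existsP; exists u; rewrite us (fintype.subsetP sB).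
Qed.

Variable alpha : R.
Hypotheses (alpha0 : 0 <= alpha) (L0 : (0 < L)%N).
Hypothesis vol_le : (Vol K n)%:R <= (1 + alpha) ^+ L.

(** Otherwise every step in radius multiplies the enclosed volume by more than [1 + alpha]. The
    first step encloses at least one simplex because the failing inequality is strict, and after [L]
    steps the volume would exceed [Vol K n]. *)
Lemma good_radius (W : {set 'I_N}) v : v \in W -> exists2 r, (r <= L)%N &
  (#|meeting W (graph_ball W v r)|%:R : R) <= (1 + alpha) * #|inside (graph_ball W v r)|%:R.
Proof.
move=> vW; apply: contrapT => /forall2NP H.
have big r : (r <= L)%N -> (1 + alpha) * #|inside (graph_ball W v r)|%:R <
    #|meeting W (graph_ball W v r)|%:R.
  by move=> rL; have [//|/negP] := H r; rewrite -ltNge.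
have a1 : 0 <= 1 + alpha by rewrite addr_ge0.
have growth r : (r <= L)%N -> (1 + alpha) ^+ r <= #|inside (graph_ball W v r.+1)|%:R.
  elim: r => [|r IH] rL.
    rewrite expr0 ler1n; apply: leq_trans (subset_leq_card (meeting_ball W v 0)).
    by rewrite -(ltr_nat R); apply: le_lt_trans (big 0 rL); rewrite mulr_ge0.
  rewrite exprS; apply: (le_trans (ler_wpM2l a1 (IH (ltnW rL)))).
  apply: (le_trans (ltW (big _ rL))); rewrite ler_nat.
  exact: subset_leq_card (meeting_ball W v r.+1).
have := big L (leqnn L); apply/negP; rewrite -leNgt.
case: L L0 growth vol_le => // l _ growth vl.
apply: (@le_trans _ _ (Vol K n)%:R).
  rewrite ler_nat subset_leq_card //; apply/fintype.subsetP => s.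
  by rewrite !inE -!andbA => /and3P[-> -> _].
by apply: (le_trans vl); rewrite exprS ler_wpM2l // growth.
Qed.

Definition bad (W : {set 'I_N}) (f : 'I_N -> bool) : {set {set 'I_N}} :=
  [set s in inside W | [exists u in s, exists w in s, a u w != f u + f w]].

(** Balls of good radius are removed one at a time, using the potential on each. Only simplices cut
    by the removed ball are newly bad; they number at most [alpha] times those inside the ball, and
    the insides of disjoint pieces add up to at most the whole. *)
Lemma decomposition (W : {set 'I_N}) : exists f, (#|bad W f|%:R : R) <= alpha * #|inside W|%:R.
Proof.
have [k] := ubnP #|W|; elim: k W => // k IH W; rewrite ltnS => Wk.
have [->|/set0Pn[v vW]] := eqVneq W finset.set0.
  exists (fun=> false); suff -> : bad finset.set0 (fun=> false) = finset.set0.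
    by rewrite cards0 mulr_ge0.
  apply/setP => s; rewrite finset.in_set0; apply/negP; rewrite !inE finset.subset0 => /andP[/andP[/andP[sK _] /eqP s0] _].
  by have := Kc.1; rewrite -s0 sK.
have [r rL rP] := good_radius vW.
set B := graph_ball W v r in rP.
have [|f fP] := IH (W :\: B).
  apply: leq_trans Wk; apply: proper_card; apply/fintype.properP; split; first exact: subsetDl.
  by exists v => //; rewrite inE graph_ball_center.
pose g u := if u \in B then potential v u else f u.
exists g.
have sub : bad W g \subset bad (W :\: B) f :|: (meeting W B :\: inside B).
  apply/fintype.subsetP => s; rewrite inE => /andP[sW /existsP[u /andP[us /existsP[w /andP[ws auw]]]]].
  have [mB|nB] := boolP [exists u in s, u \in B].
    apply/setUP; right; rewrite inE [s \in meeting _ _]inE sW mB !andbT.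
    apply: contra auw; rewrite inE => /andP[/simplicesP[sK _] sB].
    have uB := fintype.subsetP sB _ us; have wB := fintype.subsetP sB _ ws.
    by rewrite /g uB wB (potential_cochain rL sK us ws uB wB).
  have sNB x : x \in s -> x \notin B.
    by move=> xs; apply: contra nB => xB; apply/existsP; exists x; rewrite xs.
  apply/setUP; left; rewrite inE; apply/andP; split.
    move: sW; rewrite !inE => /andP[-> sW] /=; apply/fintype.subsetP => x xs.
    by rewrite inE sNB // (fintype.subsetP sW).
  apply/existsP; exists u; rewrite us /=; apply/existsP; exists w; rewrite ws /=.
  by move: auw; rewrite /g (negbTE (sNB u us)) (negbTE (sNB w ws)).
have card1 : (#|bad W g| <= #|bad (W :\: B) f| + #|meeting W B :\: inside B|)%N.
  by apply: (leq_trans (subset_leq_card sub)); rewrite cardsU leq_subr.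
have card2 : (#|meeting W B :\: inside B| + #|inside B| = #|meeting W B|)%N.
  have := cardsID (inside B) (meeting W B).
  by rewrite (finset.setIidPr (inside_meeting r vW)) addnC.
have card3 : (#|inside (W :\: B)| + #|inside B| <= #|inside W|)%N.
  rewrite -cardsUI [X in (_ + X)%N](_ : _ = 0%N) ?addn0; last first.
    apply/eqP; rewrite cards_eq0; apply/eqP/setP => s; rewrite finset.in_set0; apply/negP.
    rewrite !inE => /andP[/andP[/andP[sK _] sWB] /andP[_ sB]].
    have [u us] := set0Pn _ (simplex_nonempty Kc sK).
    by have := fintype.subsetP sWB _ us; rewrite inE (fintype.subsetP sB).
  apply: subset_leq_card; apply/fintype.subsetP => s; rewrite !inE => /orP[]/andP[-> sW] /=.
    by apply: fintype.subset_trans sW _; exact: subsetDl.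
  exact: fintype.subset_trans sW (graph_ball_sub r vW).
move: card1 card2 card3 => c1 c2 c3.
have {}c1 := c1; rewrite -(ler_nat R) natrD in c1.
have c2' : (#|meeting W B :\: inside B|%:R + #|inside B|%:R : R) = #|meeting W B|%:R by rewrite -natrD c2.
rewrite -(ler_nat R) natrD in c3.
have := ler_wpM2l alpha0 c3; rewrite mulrDr.
by lra.
Qed.

End BallGrowing.

(** * Choice of scale and the final estimate *)

Section SystolicInequality.
Variables (R : realType) (m : nat) (N : nat) (K : {set {set 'I_N}}).
Local Notation n := m.+1.
Hypotheses (Kc : simplicial_complex K) (Kp : pseudomanifold m K) (H1 : homology_nonzero K 1).

Lemma sys_le_vol (L : nat) (alpha : R) :
  (2 * L + 1 < sys K 1)%N -> 0 <= alpha -> (0 < L)%N -> (Vol K n)%:R <= (1 + alpha) ^+ L ->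
  (sys K m)%:R <= m.+2%:R * (alpha * (Vol K n)%:R).
Proof.
move=> LS a0 L0 vL; have [z [zc znb]] := H1.
have [phi phi_closed phi1] := exists_cocycle zc.1 znb.
have [u0 [v0 [uvK _]]] := cochain_nontrivial Kc zc phi1 (fun=> false).
have [f fP] := decomposition Kc phi_closed LS a0 L0 vL [set: 'I_N]%SET.
(* Correcting by the coboundary of [f] preserves the class and leaves only the bad simplices of the
   decomposition in the support. *)
pose a' u v : bool := cochain phi u v + (f u + f v).
have a'c s u v w : s \in K -> u \in s -> v \in s -> w \in s -> a' u v + a' v w = a' u w.
  move=> sK us vs ws; rewrite /a' -(cochain_cocycle Kc phi_closed sK us vs ws).
  by case: (cochain phi u v); case: (cochain phi v w); case: (f u); case: (f v); case: (f w).
have a'n F : exists u v, [set u; v]%SET \in K /\ a' u v != F u + F v.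
  have [u [v [uv ne]]] := cochain_nontrivial Kc zc phi1 (fun x => f x + F x).
  exists u, v; split=> //; apply: contra ne; rewrite /a'.
  by case: (cochain phi u v); case: (f u); case: (f v); case: (F u); case: (F v).
have := sys_le_bad Kc Kp a'c a'n u0.
rewrite -(ler_nat R) natrM => h; apply: (le_trans h); rewrite ler_wpM2l //.
apply: le_trans (le_trans fP _).
  rewrite ler_nat subset_leq_card //; apply/fintype.subsetP => s; rewrite !inE => /andP[-> /existsP[u /andP[us /existsP[v /andP[vs auv]]]]].
  rewrite finset.subsetT /=; apply/existsP; exists u; rewrite us /=; apply/existsP; exists v; rewrite vs /=.
  by move: auv; rewrite /a'; case: (cochain phi u v); case: (f u); case: (f v).
rewrite ler_wpM2l // ler_nat subset_leq_card //; apply/fintype.subsetP => s.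
by rewrite inE => /andP[].
Qed.

Lemma sys_le_trivial : (sys K m <= m.+2 * Vol K n)%N.
Proof.
have [z [zc znb]] := H1.
have [phi phi_closed phi1] := exists_cocycle zc.1 znb.
have [u0 [v0 [uvK _]]] := cochain_nontrivial Kc zc phi1 (fun=> false).
apply: leq_trans (sys_le_bad Kc Kp (cochain_cocycle Kc phi_closed) (cochain_nontrivial Kc zc phi1) u0) _.
rewrite leq_mul2l subset_leq_card ?orbT //; apply/fintype.subsetP => s.
by rewrite inE => /andP[].
Qed.

Lemma vol_gt0 : (0 < Vol K n)%N.
Proof.
have [z [zc znb]] := H1.
have [phi phi_closed phi1] := exists_cocycle zc.1 znb.
have [u0 [v0 [uvK _]]] := cochain_nontrivial Kc zc phi1 (fun=> false).
by have [t tS _] := pm_pure Kp uvK; apply/card_gt0P; exists t.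
Qed.

Lemma bernoulli (x : R) k : 0 <= x -> 1 + k%:R * x <= (1 + x) ^+ k.
Proof.
move=> x0; elim: k => [|k IH]; first by rewrite mul0r addr0 expr0.
rewrite exprS -natr1; have k0 : (0 : R) <= k%:R by rewrite ler0n.
by have := ler_wpM2l (_ : 0 <= 1 + x) IH; nra.
Qed.

Lemma systolic_inequality (eps : R) (M : nat) : 0 < eps -> (0 < M)%N -> 1 <= M%:R * eps ->
  ((sys K 1 * sys K m)%N%:R : R) <=
  (m.+2 * (4 * M + 2))%:R * ((Vol K n)%:R `^ (1 + eps)).
Proof.
move=> eps0 M0 Meps; set V : R := (Vol K n)%:R.
have V1 : 1 <= V by rewrite ler1n vol_gt0.
have V0 : 0 < V by lra.
have Ve : V `^ (1 + eps) = V * V `^ eps.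
  rewrite powRD; last by rewrite (lt0r_neq0 V0) implybT.
  by rewrite powRr1 // ltW.
have Ve1 : 1 <= V `^ eps by rewrite -(powRr0 V) ler_powR // ltW.
set S := sys K 1.
(* The largest [k] for which the radius [k * M] satisfies [2 * (k * M) + 1 < S], once [k] is
   positive; for [k = 0] the systole [S] is bounded and the trivial volume bound suffices. *)
pose k := ((S - 2) %/ (2 * M))%N.
have kM : (k * (2 * M) <= S - 2)%N by exact: leq_trunc_div.
have kS : (S - 2 < k.+1 * (2 * M))%N by apply: ltn_ceil; rewrite muln_gt0.
rewrite Ve natrM (natrM _ m.+2).
have [k0|k0] := posnP k.
  have SM : (S <= 4 * M + 2)%N by move: kS; rewrite k0; lia.
  have sm : (sys K m)%:R <= m.+2%:R * V by rewrite -natrM ler_nat sys_le_trivial.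
  apply: (@le_trans _ _ ((4 * M + 2)%:R * (m.+2%:R * V))).
    by apply: ler_pM; rewrite ?ler0n // ler_nat.
  rewrite mulrCA mulrA; apply: ler_wpM2l => //.
  by rewrite ler_peMr // ltW.
have kR : (0 : R) < k%:R by rewrite ltr0n.
have S2 : (2 * (k * M) + 1 < S)%N by move: kM; nia.
have alpha0 : 0 <= V `^ eps / k%:R by rewrite divr_ge0 // powR_ge0.
(* Bernoulli bounds the [k]-th power of [1 + alpha] below by [V] to the power [eps]; raising this to
   the power [M] gives at least [V], because [M * eps] is at least 1. *)
have vL : V <= (1 + V `^ eps / k%:R) ^+ (k * M).
  rewrite exprM; apply: (@le_trans _ _ ((V `^ eps) ^+ M)).
    rewrite -powR_mulrn ?powR_ge0 // -powRrM -[leLHS]powRr1; last exact: ltW.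
    by rewrite ler_powR // mulrC.
  rewrite lerXn2r ?nnegrE ?powR_ge0 ?exprn_ge0 ?addr_ge0 //.
  by apply: le_trans (bernoulli k alpha0); rewrite mulrCA divff ?gt_eqF // mulr1 lerDr.
have kM0 : (0 < k * M)%N by rewrite muln_gt0 k0.
have sm := sys_le_vol S2 alpha0 kM0 vL.
(* As [k] is positive, [S - 2 < 2 * M * (k + 1) <= 4 * M * k]; the factor [k] then cancels against
   the denominator of [alpha]. *)
have Sk : (S <= (4 * M + 2) * k)%N by move: kS S2; nia.
apply: (@le_trans _ _ (((4 * M + 2) * k)%:R * (m.+2%:R * (V `^ eps / k%:R * V)))).
  by apply: ler_pM; rewrite ?ler0n // ler_nat.
by rewrite natrM le_eqVlt; apply/orP; left; apply/eqP; field; rewrite gt_eqF.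
Qed.

End SystolicInequality.

Theorem theorem1p1 (R : realType) (n : nat) (eps : R) :
  (1 <= n)%N -> 0 < eps ->
  exists c : R, forall (N : nat) (K : {set {set 'I_N}}),
    simplicial_complex K ->
    closed_manifold (@realization R N K) n ->
    homology_nonzero K 1 ->
    ((sys K 1 * sys K (n - 1))%N%:R : R) <= c * ((Vol K n)%:R `^ (1 + eps)).
Proof.
case: n => [//|m] _ eps0.
pose M := (Num.trunc eps^-1).+1.
have Meps : 1 <= M%:R * eps.
  by rewrite -ler_pdivrMr // mul1r ltW // Num.Theory.truncnS_gt.
exists (m.+2 * (4 * M + 2))%:R => N K Kc Km H1; rewrite subn1 /=.
exact: systolic_inequality Kc (manifold_pseudomanifold Kc Km) H1 _ _ eps0 _ Meps.
Qed.
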